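(* The following statements are true. (i) Let $\ell\in\{1,2\}$ and let $k$ be a positive integer. Any $1$-tough $(k+\ell-1)$-connected $(P_{2\ell}\cup kP_1)$-free graph with at least three vertices has a $2$-factor. (ii) Let $k$ be a positive integer. Any $1$-tough $(k+1)$-connected $(P_3\cup kP_1)$-free graph with at least three vertices has a $2$-factor.
   Context: Graphs are finite and simple. $P_n$ denotes the path on $n$ vertices; $H\cup F$ denotes the disjoint union of vertex-disjoint graphs $H$ and $F$; $kP_1$ denotes the disjoint union of $k$ copies of $P_1$ (i.e. $k$ isolated vertices). A graph $G$ is $H$-free if $G$ does not contain $H$ as an induced subgraph. A connected graph is $m$-connected if it has more than $m$ vertices and remains connected whenever fewer than $m$ vertices are deleted. A $2$-factor of $G$ is a spanning subgraph of $G$ in which every vertex has degree $2$ (not necessarily connected). For a graph $H$, $c(H)$ denotes the number of connected components of $H$, and for $S\subset V(G)$, $G-S$ is the subgraph of $G$ induced by $V(G)\setminus S$. The toughness $\tau(G)$ is $\infty$ if $G$ is complete; otherwise $\tau(G)=\min \frac{|S|}{c(G-S)}$, the minimum being over all vertex cuts $S$ of $G$, i.e. all $S\subset V(G)$ with $c(G-S)>1$. For a positive real number $t$, $G$ is $t$-tough if $\tau(G)\ge t$. *)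

(* Defs.v *)
From mathcomp Require Import all_boot all_order all_algebra.
From mathcomp Require Import constructive_ereal.

Set Implicit Arguments.
Unset Strict Implicit.
Unset Printing Implicit Defensive.

Record sgraph := SGraph {
  vertex :> finType;
  adj : rel vertex;
  adj_sym : symmetric adj;
  adj_irr : irreflexive adj }.

Definition path_adj n : rel 'I_n :=
  fun i j => (i.+1 == j :> nat) || (j.+1 == i :> nat).

Lemma path_adj_sym n : symmetric (@path_adj n).
Proof. by move=> i j; exact: orbC. Qed.

Lemma path_adj_irr n : irreflexive (@path_adj n).
Proof. by move=> i; rewrite /path_adj gtn_eqF. Qed.

Definition path_graph n := SGraph (@path_adj_sym n) (@path_adj_irr n).

Definition union_adj (G H : sgraph) : rel (G + H) := fun x y =>
  match x, y with
  | inl a, inl b => adj a b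
  | inr a, inr b => adj a b
  | _, _ => false
  end.

Lemma union_adj_sym G H : symmetric (@union_adj G H).
Proof. by move=> [a|a] [b|b] //=; apply: adj_sym. Qed.

Lemma union_adj_irr G H : irreflexive (@union_adj G H).
Proof. by move=> [a|a] /=; apply: adj_irr. Qed.

Definition disjoint_union G H :=
  SGraph (@union_adj_sym G H) (@union_adj_irr G H).

Definition copies_adj k (G : sgraph) : rel ('I_k * G) :=
  fun x y => (x.1 == y.1) && adj x.2 y.2.

Lemma copies_adj_sym k G : symmetric (@copies_adj k G).
Proof. by move=> x y; rewrite /copies_adj eq_sym adj_sym. Qed.

Lemma copies_adj_irr k G : irreflexive (@copies_adj k G).
Proof. by move=> x; rewrite /copies_adj adj_irr andbF. Qed.

Definition copies k G := SGraph (@copies_adj_sym k G) (@copies_adj_irr k G).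

Definition induced_adj (G : sgraph) (A : {set G}) : rel {x : G | x \in A} :=
  fun x y => adj (val x) (val y).

Lemma induced_adj_sym G A : symmetric (@induced_adj G A).
Proof. by move=> x y; apply: adj_sym. Qed.

Lemma induced_adj_irr G A : irreflexive (@induced_adj G A).
Proof. by move=> x; apply: adj_irr. Qed.

Definition induced G A := SGraph (@induced_adj_sym G A) (@induced_adj_irr G A).

Definition delete (G : sgraph) (S : {set G}) := induced (~: S).

Definition isomorphic (G H : sgraph) : Prop :=
  exists2 f : G -> H, bijective f & {mono f : x y / adj x y}.

Definition induced_free (H G : sgraph) : Prop :=
  ~ exists A : {set G}, isomorphic (induced A) H.

Definition num_comp (G : sgraph) : nat := n_comp (@adj G) [set: G].

(* The graph without vertices has no component, hence is not connected. *)
Definition connected (G : sgraph) : bool := num_comp G == 1.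

Definition m_connected (m : nat) (G : sgraph) : Prop :=
  [/\ connected G, m < #|G|
    & forall S : {set G}, #|S| < m -> connected (delete S)].

Definition complete (G : sgraph) : bool :=
  [forall x : G, forall y : G, (x != y) ==> adj x y].

Definition vertex_cut (G : sgraph) (S : {set G}) : bool :=
  1 < num_comp (delete S).

(* A graph that is not complete has a vertex cut (the complement of two
   nonadjacent vertices), so the index +oo of the iterated minimum is never
   its value. Toughness is rational or infinite, so no reals are needed. *)
Definition toughness (G : sgraph) : \bar rat :=
  if complete G then +oo%E
  else \big[Order.min/+oo%E]_(S : {set G} | vertex_cut S)
         ((#|S|%:R / (num_comp (delete S))%:R)%R)%:E.

Definition tough (t : rat) (G : sgraph) : Prop := (t%:E <= toughness G)%E.

(* A spanning subgraph is given by its adjacency relation on the vertices of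
   G; it is irreflexive because adj is. *)
Definition spanning_subgraph (G : sgraph) (F : rel G) : Prop :=
  symmetric F /\ subrel F (@adj G).

Definition has_2factor (G : sgraph) : Prop :=
  exists2 F : rel G, spanning_subgraph F & forall x, #|[set y | F x y]| = 2.

(* Main.v *)
Require Import Defs.
From mathcomp Require Import all_boot all_order all_algebra.
From mathcomp Require Import constructive_ereal zify.

Set Implicit Arguments.
Unset Strict Implicit.
Unset Printing Implicit Defensive.

(** Suppose that G has no 2-factor. Tutte's 2-factor theorem then yields
    disjoint vertex sets S and T and a family P of components of G - S - T (the
    blocks), each joined to T by an odd number e(C,T) of edges, with

      2|S| + (sum of e(C,T) over P) + 2 <= 2|T| + |P|.

    For an optimal choice of S and T (has_2factor_or_biased_barrier), T is
    independent, every edge leaving T ends in S or in a block, and the edges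
    between T and a block form a matching.

    If e(C,T) = 1 for all blocks, then |S| < |T| and deleting S separates the
    vertices of T from one another, each of them keeping only the blocks hooked
    to it: this violates 1-toughness. The case |T| = 1 is separate, because
    deleting S need not give two components there; but then S is empty and G
    has a cut vertex.

    Otherwise some block C has e(C,T) >= 3. One finds an induced P_2 = xt, or an
    induced P_4 starting with an edge between T and C, that is adjacent to, or
    contains, at most one (resp. two) vertices of the independent set T; so
    freeness forces |T| <= r, where r is the assumed connectivity
    (P2_free_barrier, P4_free_barrier). Small cuts then appear
    (biased_barrier_contradiction). If some block C0 has e(C0,T) = 1, the
    inequality above gives |S| + 2 <= |T| <= r, and S together with the only
    neighbour of C0 in T is a cut with fewer than r vertices. If e(C,T) >= 3 for
    all blocks, it gives |S| + |P| + 1 <= |T| <= r; a vertex t of T has at most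
    one neighbour in each block, so S and the neighbours of t form a cut with
    fewer than r vertices. The statement on P_3 follows from the one on P_4,
    since a (P_3 + kP_1)-free graph is (P_4 + kP_1)-free and both ask for
    (k+1)-connectivity.

    The 2-factor theorem is reduced to perfect matchings by Tutte's gadget:
    every vertex becomes two copies, every edge vw becomes two adjacent darts
    (v,w) and (w,v), and the copies of v are joined to the darts leaving v. A
    barrier of the gadget that maximises first the number of vertices with both
    copies in it, and then is as small as possible, reads off as the pair (S,T).
    The theorem on perfect matchings is proved by Gallai's argument
    (gallai_missed_trans, tutte_berge). *)

(** * Maximum matchings and the Tutte-Berge theorem *)

Lemma card_involution_even (T : finType) (h : T -> T) (A : {set T}) :
  {in A, forall x, [/\ h x \in A, h (h x) = x & h x != x]} -> ~~ odd #|A|.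
Proof.
have [n leAn] := ubnP #|A|; elim: n => // n IHn in A leAn *.
move=> hA; have [->|[x xA]] := set_0Vmem A; first by rewrite cards0.
have [hxA hhx hxx] := hA x xA.
have hxA1 : h x \in A :\ x by rewrite !inE hxx.
have cA : #|A| = #|A :\ x :\ h x|.+2.
  by rewrite (cardsD1 x A) xA (cardsD1 (h x) (A :\ x)) hxA1.
rewrite cA /= negbK; apply: IHn; first by rewrite cA in leAn; lia.
move=> y; rewrite !inE => /and3P[yhx yx yA].
have [hyA hhy hyy] := hA y yA; split=> //; rewrite hyA andbT.
apply/andP; split; apply/eqP => E.
  by move: yx; rewrite -hhy E hhx eqxx.
by move: yhx; rewrite -E hhy eqxx.
Qed.

Section Matchings.

Variables (V : finType) (e : rel V).
Hypothesis e_sym : symmetric e.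

Implicit Types (W X A B C D R N : {set V}) (P Q : {set {set V}}) (f g : {ffun V -> V}).

(** A matching is encoded as an involution whose moved points are the matched
    vertices; this makes parity statements instances of card_involution_even. *)
Definition matching (W : {set V}) (f : {ffun V -> V}) :=
  [forall x, (f (f x) == x) && ((f x != x) ==> (x \in W) && e x (f x))].

Definition covered (f : {ffun V -> V}) := [set x | f x != x].

Definition maximum_matching (W : {set V}) (f : {ffun V -> V}) :=
  matching W f && [forall g, matching W g ==> (#|covered g| <= #|covered f|)].

Lemma matchingP W f :
  reflect ((forall x, f (f x) = x) /\
           (forall x, f x != x -> x \in W /\ e x (f x))) (matching W f).
Proof.
apply: (iffP forallP) => [H|[H1 H2] x].
  split=> x; have /andP[/eqP ? /implyP K] := H x; first by [].
  by move=> /K /andP[].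
by rewrite H1 eqxx /=; apply/implyP => /H2[-> ->].
Qed.

Lemma maximum_matchingP W f :
  reflect (matching W f /\
           forall g, matching W g -> #|covered g| <= #|covered f|)
          (maximum_matching W f).
Proof.
apply: (iffP andP) => -[Mf H]; split=> //.
  by move=> g Mg; have /forallP/(_ g)/implyP/(_ Mg) := H.
by apply/forallP => g; apply/implyP/H.
Qed.

Lemma exists_maximum_matching W : exists f : {ffun V -> V}, maximum_matching W f.
Proof.
have M0 : matching W [ffun x => x].
  by apply/matchingP; split=> x; rewrite !ffunE // eqxx.
case: (arg_maxnP (fun f => #|covered f|) M0) => f Mf Hf.
by exists f; apply/maximum_matchingP.
Qed.

Lemma covered_even W f : matching W f -> ~~ odd #|covered f|.
Proof.
move=> /matchingP[ff _]; apply: (@card_involution_even _ f) => x.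
by rewrite !inE ff eq_sym => fx; split=> //; rewrite eq_sym.
Qed.

Lemma covered_sub W f : matching W f -> covered f \subset W.
Proof. by move=> /matchingP[_ H]; apply/subsetP => x; rewrite inE => /H[]. Qed.

(** Adds the edge xy to a matching that misses x, dropping the edge at y if there is
    one. When f y = y the last test is void and this is plain augmentation. *)
Definition rematch (f : {ffun V -> V}) x y :=
  [ffun p => if p == x then y else if p == y then x else
             if p == f y then p else f p].

Lemma rematch_matching W f x y : matching W f -> x \in W -> y \in W ->
  x != y -> e x y -> f x = x -> matching W (rematch f x y).
Proof.
move=> /matchingP[ff fW] xW yW xy exy fx.
have yx : y != x by rewrite eq_sym.
have fE p : (f p == x) = (p == x).
  by apply/eqP/eqP => [E|->//]; rewrite -(ff p) E fx.
have fE2 p : (f p == y) = (p == f y).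
  by apply/eqP/eqP => [<-|->]; rewrite ff.
apply/matchingP; split=> p; rewrite !ffunE.
  have [->|px] := eqVneq p x; first by rewrite (negPf yx) eqxx.
  have [->|py] := eqVneq p y; first by rewrite eqxx.
  have [pf|pf] := eqVneq p (f y); first by rewrite (negPf px) (negPf py) pf eqxx.
  rewrite fE (negPf px) fE2 (negPf pf) (can_eq ff) (negPf py); exact: ff.
have [->|px] := eqVneq p x; first by rewrite xW exy.
have [->|py] := eqVneq p y; first by rewrite yW e_sym exy.
by have [pf|pf] := eqVneq p (f y); [rewrite eqxx | exact: fW].
Qed.

Lemma covered_rematch f x y : x != y ->
  covered (rematch f x y) =
  x |: (y |: covered f :\ f y).
Proof.
move=> xy; apply/setP => p; rewrite !inE !ffunE.
have [->|px] /= := eqVneq p x; first by rewrite eq_sym xy.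
have [->|py] /= := eqVneq p y; first by rewrite xy.
by have [->|pf] /= := eqVneq p (f y); rewrite ?eqxx.
Qed.

Lemma maximum_missed_adj W f x y : maximum_matching W f ->
  x \in W -> y \in W -> x != y -> e x y -> f x = x -> f y != y.
Proof.
move=> /maximum_matchingP[Mf maxf] xW yW xy exy fx; apply/eqP => fy.
have := maxf _ (rematch_matching Mf xW yW xy exy fx).
rewrite covered_rematch // fy cardsU1 cardsU1 !inE !fx !fy !eqxx.
rewrite (negPf xy) /=.
have -> : covered f :\ y = covered f.
  by apply/setP => p; rewrite !inE; case: eqVneq => // ->; rewrite fy eqxx.
by rewrite ltnNge leqnSn.
Qed.

Definition agreement (f g : {ffun V -> V}) := [set x | (f x == g x) && (f x != x)].

(** Gallai's lemma: when every vertex is missed by some maximum matching, the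
    relation of not being missed together is transitive. Take M missing u and v
    and, among the maximum matchings missing t, the one N that shares most edges
    with M. As N covers u and v, which M misses, M covers some x <> t missed by
    N; exchanging the N-edge at M x for the edge x (M x) gives a maximum
    matching that still misses t and shares more with M. *)
Lemma gallai_missed_trans W :
  (forall v, v \in W ->
     exists2 f : {ffun V -> V}, maximum_matching W f & f v = v) ->
  forall t u v, t \in W -> u \in W -> v \in W ->
  u != v ->
  (forall f, maximum_matching W f -> f u = u -> f t = t -> u = t) ->
  (forall f, maximum_matching W f -> f t = t -> f v = v -> t = v) ->
  forall f, maximum_matching W f -> f u = u -> f v = v -> False.
Proof.
move=> missable t u v tW uW vW uv Rut Rtv M Mmax Mu Mv.
have [g0 g0max g0t] := missable t tW.
pose P g := maximum_matching W g && (g t == t).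
have Pg0 : P g0 by rewrite /P g0max g0t eqxx.
case: (arg_maxnP (fun g => #|agreement M g|) Pg0) => N /andP[Nmax /eqP Nt] maxN.
have ut : u != t.
  by apply/eqP => E; move/eqP: uv; apply; rewrite E; apply: (Rtv M) => //; rewrite -E.
have tv : t != v.
  by apply/eqP => E; move/eqP: uv; apply; rewrite -E; apply: (Rut M) => //; rewrite E.
have Mt : M t != t by apply/eqP => E; move/eqP: ut; apply; apply: (Rut M).
have Nu : N u != u by apply/eqP => E; move/eqP: ut; apply; apply: (Rut N).
have Nv : N v != v by apply/eqP => E; move/eqP: tv; apply; apply: (Rtv N).
have [MM leM] := maximum_matchingP _ _ Mmax.
have [NM leN] := maximum_matchingP _ _ Nmax.
have cMN : #|covered M| = #|covered N|.
  by apply/eqP; rewrite eqn_leq leM ?leN.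
(* M and N have the same size, and N covers u and v, which M does not. *)
have [x [xt Mx Nx]] : exists x, [/\ x != t, M x != x & N x = x].
  have : 1 < #|covered M :\: covered N|.
    have: 1 < #|covered N :\: covered M|.
      have/subset_leq_card: [set u; v] \subset covered N :\: covered M.
        by apply/subsetP => y /set2P[]->; rewrite !inE ?Mu ?Mv ?eqxx ?Nu ?Nv.
      by rewrite cards2 uv.
    have := cardsID (covered N) (covered M); have := cardsID (covered M) (covered N).
    by rewrite setIC cMN; clear; lia.
  move=> c2; have : 0 < #|(covered M :\: covered N) :\ t|.
    by move: c2; rewrite (cardsD1 t (_ :\: _)); by case: (t \in _) => /=; clear; lia.
  move=> /card_gt0P[x]; rewrite !inE negbK => /and3P[? /eqP ? ?].
  by exists x; split.
have [MMK MW] := matchingP _ _ MM.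
have [NNK NW] := matchingP _ _ NM.
pose y := M x.
have [xW exy] := MW x Mx.
have Myx : M y = x by rewrite /y MMK.
have [yW _] : y \in W /\ e y (M y) by apply: MW; rewrite Myx eq_sym.
have xy : x != y by rewrite eq_sym.
have Ny : N y != y by apply: (maximum_missed_adj Nmax xW yW).
have NM' := rematch_matching NM xW yW xy exy Nx.
have NyW : N y \in covered N :\ y by rewrite !inE Ny NNK eq_sym Ny.
have cN' : #|covered (rematch N x y)| = #|covered N|.
  rewrite covered_rematch //.
  have -> : y |: covered N :\ N y = covered N :\ N y.
    by apply/setUidPr; rewrite sub1set !inE eq_sym Ny.
  rewrite cardsU1 !inE Nx eqxx andbF /= add1n.
  by rewrite [in RHS](cardsD1 (N y)) !inE NNK eq_sym Ny.
have N't : rematch N x y t = t.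
  rewrite ffunE eq_sym (negPf xt).
  have [ty|ty] := eqVneq t y; first by move: Ny; rewrite -ty Nt eqxx.
  by case: ifP.
have PN' : P (rematch N x y).
  rewrite /P N't eqxx andbT; apply/maximum_matchingP; split=> // g Mg.
  by rewrite cN' leN.
have := maxN _ PN'; rewrite /= leqNgt => /negP; apply; apply: proper_card.
apply/properP; split; last first.
  by exists x; rewrite !inE ?ffunE ?eqxx ?Mx // Nx (negPf Mx).
apply/subsetP => p; rewrite !inE !ffunE => /andP[/eqP Mp Mpp].
rewrite Mpp andbT.
have [->|px] := eqVneq p x; first by [].
have [->|py] := eqVneq p y; first by rewrite Myx.
have [pf|pf] := eqVneq p (N y); last by rewrite Mp.
have E : M (N y) = y by rewrite -pf Mp pf NNK.
by case/negP: px; apply/eqP; rewrite pf -(MMK (N y)) E.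
Qed.


Definition closed_in (X C : {set V}) :=
  [forall x in C, forall y in X, e x y ==> (y \in C)].

(** Blocks are only required to be unions of components of X, not components.
    Such certificates are stable under enlarging or shrinking the barrier,
    without any recomputation of components; exists_connected_blocks recovers
    connectedness at the end. *)
Definition odd_blocks (X : {set V}) (P : {set {set V}}) :=
  trivIset P && [forall C in P, [&& C \subset X, odd #|C| & closed_in X C]].

Lemma closed_inP (X C : {set V}) :
  reflect (forall x y, x \in C -> y \in X -> e x y -> y \in C) (closed_in X C).
Proof.
apply: (iffP forall_inP) => [H x y xC yX|H x xC].
  by have /forall_inP/(_ y yX)/implyP := H x xC.
by apply/forall_inP => y yX; apply/implyP; apply: H xC yX.
Qed.

Lemma odd_blocksP (X : {set V}) P :
  reflect ({in P &, forall C D x, x \in C -> x \in D -> C = D} /\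
           {in P, forall C, [/\ C \subset X, odd #|C| & closed_in X C]})
          (odd_blocks X P).
Proof.
apply: (iffP andP) => [[/trivIsetP tP /forall_inP H]|[tP H]]; split.
- move=> C D CP DP x xC xD; apply/eqP/negP => /negP CD.
  by have /pred0P/(_ x) := tP C D CP DP CD; rewrite /= xC xD.
- by move=> C /H/and3P.
- apply/trivIsetP => C D CP DP CD; apply/pred0P => x /=; apply/negP.
  by move=> /andP[xC xD]; rewrite (tP C D CP DP x) ?eqxx in CD.
- by apply/forall_inP => C /H/and3P.
Qed.

(** By induction on W. A vertex v covered by all maximum matchings goes into the
    barrier: deleting it raises the deficiency. If there is no such v, Gallai's
    lemma shows that a maximum matching misses at most one vertex in each
    component, so the components of its missed vertices are odd and A is empty. *)
Lemma tutte_berge W d :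
  (forall f, matching W f -> d <= #|W :\: covered f|) ->
  exists A P, [/\ A \subset W, odd_blocks (W :\: A) P & #|A| + d <= #|P|].
Proof.
have [n leWn] := ubnP #|W|; elim: n => // n IHn in W d leWn * => Hd.
have cov f : matching W f -> #|W :\: covered f| + #|covered f| = #|W|.
  by move=> /covered_sub/setIidPr fW; rewrite -(cardsID (covered f) W) fW addnC.
have [/existsP[v /andP[vW /forallP Hv]]|] :=
  boolP [exists v, (v \in W) && [forall f, maximum_matching W f ==> (f v != v)]].
  have cW : #|W :\ v| < n by move: leWn; rewrite (cardsD1 v W) vW; lia.
  (* A matching avoiding v is not maximum, and covered sets have even size, so it
     loses two vertices; one of them is accounted for by v itself. *)
  have [f Mf|A [P [AW oP AP]]] := IHn _ d.+1 cW.
    have [ff fW] := matchingP _ _ Mf.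
    have fv : f v = v.
      by apply/eqP/negP => /negP /fW[]; rewrite !inE eqxx.
    have MfW : matching W f.
      by apply/matchingP; split=> // x /fW[]; rewrite !inE => /andP[].
    have [g gmax] := exists_maximum_matching W.
    have [Mg leg] := maximum_matchingP _ _ gmax.
    have lt_fg : #|covered f| < #|covered g|.
      rewrite ltnNge; apply/negP => le_gf; have /implyP Hf := Hv f.
      suff: f v != v by rewrite fv eqxx.
      apply: Hf; apply/maximum_matchingP; split=> // h /leg; move/leq_trans; exact.
    have gap : #|covered f|.+2 <= #|covered g|.
      rewrite ltn_neqAle lt_fg andbT; apply/eqP => E.
      by have := covered_even Mg; rewrite -E /= negbK (negPf (covered_even Mf)).
    have := Hd g Mg; have := cov _ Mg; have := cov _ MfW.
    have -> : W :\ v :\: covered f = (W :\: covered f) :\ v.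
      by rewrite !setDDl setUC.
    rewrite (cardsD1 v (W :\: covered f)) !inE fv eqxx vW /=.
    have arith a b c c' w : c.+2 <= c' -> 1 + a + c = w -> b + c' = w -> d <= b -> d < a.
      by clear; lia.
    exact: arith gap.
  exists (v |: A), P; split.
  - by rewrite subUset sub1set vW (subset_trans AW) ?subD1set.
  - by rewrite -setDDl.
  - by rewrite cardsU1; move: AP (leq_b1 (v \notin A)); clear; lia.
move=> /existsPn H.
have missable v : v \in W -> exists2 f : {ffun V -> V}, maximum_matching W f & f v = v.
  move=> vW; have := H v; rewrite vW /= => /forallPn[f].
  by rewrite negb_imply negbK => /andP[? /eqP]; exists f.
pose Rel x y := [/\ x \in W, y \in W & forall f, maximum_matching W f ->
  f x = x -> f y = y -> x = y].
have RelT : forall x y z, Rel x y -> Rel y z -> Rel x z.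
  move=> x y z [xW yW Rxy] [_ zW Ryz]; split=> // f fmax fx fz.
  by apply/eqP/negP => /negP xz; apply: (gallai_missed_trans missable yW xW zW xz Rxy Ryz fmax).
pose r x y := [&& x \in W, y \in W & e x y].
have rRel x y : x != y -> r x y -> Rel x y.
  move=> xy /and3P[xW yW exy]; split=> // f fmax fx fy.
  by have := maximum_missed_adj fmax xW yW xy exy fx; rewrite fy eqxx.
have cRel x y : x \in W -> connect r x y -> Rel x y.
  move=> xW /connectP[p]; elim: p x xW => [|z p IHp] x xW /=; first by move=> _ ->.
  move=> /andP[rxz rp] yE; have [_ zW _] := and3P rxz.
  have Rzy := IHp z zW rp yE.
  by have [->|xz] := eqVneq x z; last apply: RelT (rRel _ _ xz rxz) _.
have r_sym : symmetric r by move=> x y; rewrite /r e_sym andbCA.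
have [M Mmax] := exists_maximum_matching W.
have [MM leM] := maximum_matchingP _ _ Mmax.
have [MMK MW] := matchingP _ _ MM.
pose comp x := [set y | connect r x y].
have rc_sym := sym_connect_sym r_sym.
have compE x y : (y \in comp x) = connect r x y by rewrite inE.
have comp_inj x y z : x \in W -> y \in W -> M x = x -> M y = y ->
    z \in comp x -> z \in comp y -> x = y.
  rewrite !compE (rc_sym y) => xW yW Mx My xz zy.
  by have [_ _ Rxy] := cRel x y xW (connect_trans xz zy); apply: (Rxy M).
have missedP x : x \in W :\: covered M -> x \in W /\ M x = x.
  by rewrite !inE negbK => /andP[/eqP].
exists set0, (comp @: (W :\: covered M)); split; first exact: sub0set.
  rewrite setD0; apply/odd_blocksP; split.
    move=> _ _ /imsetP[x /missedP[xW Mx] ->] /imsetP[y /missedP[yW My] ->] z zx zy.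
    by rewrite (comp_inj x y z).
  move=> _ /imsetP[x /missedP[xW Mx] ->].
  have compW y : y \in comp x -> y \in W by rewrite compE => /(cRel x y xW)[].
  split; first exact/subsetP.
    have xx : x \in comp x by rewrite compE connect0.
    rewrite (cardsD1 x) xx /=.
    (* M pairs off the vertices of the component of x other than x. *)
    apply: (@card_involution_even _ M) => y; rewrite !inE -/(comp x) => /andP[yx cxy].
    have yW : y \in W by apply: compW; rewrite compE.
    have My : M y != y.
      apply/eqP => My; case/eqP: yx; apply: (comp_inj _ _ y) => //.
        by rewrite compE connect0.
      by rewrite compE.
    have [_ eyM] := MW y My.
    have MyW : M y \in W by have [] := MW (M y) _; rewrite ?MMK 1?eq_sym.
    split=> //; apply/andP; split.
      by apply/eqP => E; move: yx; rewrite -(MMK y) E Mx eqxx.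
    by apply: connect_trans cxy (connect1 _); apply/and3P.
  apply/closed_inP => y z yc zW eyz; have yW := compW y yc.
  move: yc; rewrite !compE => cxy.
  by apply: connect_trans cxy (connect1 _); apply/and3P.
rewrite cards0 add0n card_in_imset; first exact: Hd.
move=> x y /missedP[xW Mx] /missedP[yW My] E.
have xx : x \in comp x by rewrite compE connect0.
by apply: (comp_inj x y x); rewrite // -E.
Qed.


(** * Modifying barriers *)

Lemma odd_blocks_parity X P : odd_blocks X P -> odd #|cover P| = odd #|P|.
Proof.
move=> /andP[/eqP <- /forall_inP H]; rewrite -sum1_card.
rewrite !(big_morph odd oddD (erefl _)).
by apply: eq_bigr => C /H/and3P[].
Qed.

Lemma closed_in_cover X P : odd_blocks X P -> closed_in X (cover P).
Proof.
move=> /odd_blocksP[_ H]; apply/closed_inP => x y /bigcupP[C CP xC] yX exy.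
have [_ _ /closed_inP cC] := H C CP.
by apply/bigcupP; exists C => //; apply: cC exy.
Qed.

Lemma closed_inD X C D : C \subset X -> closed_in X C -> closed_in X D ->
  closed_in X (C :\: D).
Proof.
move=> /subsetP CX /closed_inP cC /closed_inP cD.
apply/closed_inP => x y /setDP[xC xD] yX exy; rewrite inE (cC x) // andbT.
by apply: contra xD => yD; apply: (cD y); rewrite ?CX // e_sym.
Qed.

Lemma odd_blocksU1 X P R : odd_blocks X P -> R \subset X -> odd #|R| ->
  closed_in X R -> [disjoint R & cover P] -> odd_blocks X (R |: P) /\ R \notin P.
Proof.
move=> /odd_blocksP[tP H] RX oR cR /pred0P RP.
have RC C x : C \in P -> x \in R -> x \in C -> False.
  move=> CP xR xC; have := RP x; rewrite /= xR /=.
  by move/negP; apply; apply/bigcupP; exists C.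
split.
  apply/odd_blocksP; split.
    move=> C D /setU1P[->|CP] /setU1P[->|DP] // x xC xD.
    - by case: (RC D x).
    - by case: (RC C x).
    - exact: tP xC xD.
  by move=> C /setU1P[->|/H].
apply/negP => PR; have [x xR] : exists x, x \in R.
  by apply/set0Pn; apply: contraTneq oR => ->; rewrite cards0.
exact: (RC R x).
Qed.

Lemma odd_blocksS X P Q : odd_blocks X P -> Q \subset P -> odd_blocks X Q.
Proof.
move=> /odd_blocksP[tP H] /subsetP QP; apply/odd_blocksP; split.
  by move=> C D /QP CP /QP; apply: tP.
by move=> C /QP/H.
Qed.

Definition barrier W A :=
  (A \subset W) && [exists P : {set {set V}}, odd_blocks (W :\: A) P && (#|A| < #|P|)].

Lemma barrierP W A :
  reflect (A \subset W /\ exists2 P, odd_blocks (W :\: A) P & #|A| < #|P|)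
          (barrier W A).
Proof.
apply: (iffP andP) => -[AW].
  by move=> /existsP[P /andP[]]; split=> //; exists P.
by move=> [P oP cP]; split=> //; apply/existsP; exists P; rewrite oP.
Qed.

(** The surplus |P| - |A| has the parity of |W| unless the part of W outside A and
    the blocks is odd, and then that part is one more block. *)
Lemma barrier_gap W A : ~~ odd #|W| -> barrier W A ->
  exists2 P, odd_blocks (W :\: A) P & #|A| + 2 <= #|P|.
Proof.
move=> evW /barrierP[AW [P oP]]; rewrite leq_eqVlt => /orP[/eqP cP|]; last first.
  by exists P => //; rewrite addn2.
pose X := W :\: A; pose R := X :\: cover P.
have cX : closed_in X X by apply/closed_inP.
have coverX : cover P \subset X.
  apply/bigcupsP => C CP; have [_ H] := odd_blocksP _ _ oP.
  by have [] := H C CP.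
have cR : closed_in X R by apply: closed_inD => //; apply: closed_in_cover.
have RX : R \subset X by apply: subsetDl.
have oR : odd #|R|.
  have eqR : #|R| + #|cover P| = #|X|.
    by rewrite -(cardsID (cover P) X) (setIidPr coverX) addnC.
  have eqX : #|X| + #|A| = #|W|.
    by rewrite -(cardsID A W) (setIidPr AW) addnC.
  have := odd_blocks_parity oP; rewrite -cP; move: evW; rewrite -eqX -eqR !oddD /=.
  by case: (odd #|R|); case: (odd #|cover P|); case: (odd #|A|).
have [|oRP RP] := odd_blocksU1 oP RX oR cR.
  by rewrite -setI_eq0 /R setDE -setIA (setIC _ (cover P)) setICr setI0.
by exists (R |: P) => //; rewrite cardsU1 RP; lia.
Qed.

(** The blocks without a neighbour in B survive the removal of B from the barrier.
    The bound tolerates the loss of one more block than |B|, which is what the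
    parity gap of 2 allows; so a minimal barrier sees many blocks from each of
    its subsets. *)
Lemma barrier_shrink W A P B (N : {set V}) :
  odd_blocks (W :\: A) P -> #|A| + 2 <= #|P| -> A \subset W -> B \subset A ->
  (forall x y, x \in B -> y \in W :\: A -> e x y -> y \in N) ->
  #|pblock P @: (N :&: cover P)| <= #|B| + 1 -> barrier W (A :\: B).
Proof.
move=> oP cP AW BA NB cN; apply/barrierP; split.
  by apply: subset_trans AW; apply: subsetDl.
pose Q := P :\: (pblock P @: (N :&: cover P)).
have trP := andP oP; case: trP => trP _.
have [tP H] := odd_blocksP _ _ oP.
exists Q; last first.
  have := cardsID (pblock P @: (N :&: cover P)) P.
  have := subset_leq_card (subsetIr P (pblock P @: (N :&: cover P))).
  have := cardsID B A; rewrite (setIidPr BA) -/Q.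
  have arith a b c d p q k : b + d = a -> c <= k -> c + q = p -> a + 2 <= p ->
    k <= b + 1 -> d < q by clear; lia.
  by move=> h1 h2 h3; apply: arith h1 h2 h3 cP cN.
apply/odd_blocksP; split.
  by move=> C D /setDP[CP _] /setDP[DP _]; apply: tP.
move=> C /setDP[CP CN]; have [CX oC /closed_inP cC] := H C CP; split=> //.
  by apply: subset_trans CX _; apply: setDS; apply: subsetDl.
apply/closed_inP => x y xC; rewrite !inE negb_and negbK => /andP[yAB yW] exy.
have [yB|yB] := boolP (y \in B).
  case/imsetP: CN; exists x; last by rewrite (def_pblock trP CP xC).
  rewrite inE; apply/andP; split; last by apply/bigcupP; exists C.
  by apply: (NB y) => //; [apply: (subsetP CX) | rewrite e_sym].
by apply: (cC x) => //; rewrite (negPf yB) /= in yAB; rewrite inE yAB.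
Qed.

(** Choose the blocks with smallest total size: if a block C had a proper closed
    part D, one of D and its complement in C would be odd and could replace C. *)
Lemma exists_connected_blocks X P : odd_blocks X P ->
  exists P', [/\ odd_blocks X P', #|P'| = #|P| &
    forall C D, C \in P' -> D \subset C -> D != set0 -> closed_in X D -> D = C].
Proof.
move=> oP; pose good P' := odd_blocks X P' && (#|P'| == #|P|).
have gP : good P by rewrite /good oP eqxx.
case: (arg_minnP (fun P' => #|cover P'|) gP) => Q /andP[oQ /eqP cQ] minQ.
exists Q; split=> // C D CQ DC D0 cD; apply/eqP; rewrite eqEsubset DC /=.
apply/negPn/negP => CD.
have [tQ H] := odd_blocksP _ _ oQ; have [CX oC cC] := H C CQ.
have trQ := andP oQ; case: trQ => trQ _.
have DX := subset_trans DC CX.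
have [E [EC oE cE cEC]] : exists E : {set V}, [/\ E \subset C, odd #|E|, closed_in X E & #|E| < #|C|].
  have cDC : #|D| + #|C :\: D| = #|C| by rewrite -(cardsID D C) (setIidPr DC).
  have D1 : 0 < #|D| by rewrite card_gt0.
  have D2 : 0 < #|C :\: D| by rewrite card_gt0 setD_eq0.
  have [oD|oD] := boolP (odd #|D|).
    by exists D; split=> //; move: cDC D2; clear; lia.
  exists (C :\: D); split.
  - exact: subsetDl.
  - by move: oC; rewrite -cDC oddD (negPf oD).
  - exact: closed_inD.
  - by move: cDC D1; clear; lia.
have oQC : odd_blocks X (Q :\ C) by apply: odd_blocksS oQ (subD1set _ _).
have dE : [disjoint E & cover (Q :\ C)].
  rewrite (coverD1 trQ CQ) disjoint_sym -setI_eq0 -subset0.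
  apply/subsetP => x; rewrite !inE => /andP[/andP[xC _] /(subsetP EC)].
  by rewrite (negPf xC).
have [oEQ EQ] := odd_blocksU1 oQC (subset_trans EC CX) oE cE dE.
have gE : good (E |: Q :\ C).
  by rewrite /good oEQ cardsU1 EQ -cQ (cardsD1 C Q) CQ eqxx.
have := minQ _ gE; rewrite leqNgt => /negP; apply.
have [/eqP <- _] := andP oEQ; have /eqP <- := trQ.
rewrite big_setU1 //= (big_setD1 C CQ) /= ltn_add2r; exact: cEC.
Qed.

End Matchings.

(** * Tutte's gadget and biased barriers *)

Section Gadget.

Variable G : sgraph.

(** inl (v, i) is the i-th copy of v and inr (v, w) the dart from v to w. Pairs of
    nonadjacent vertices are also points of this type; gadget_set excludes them. *)
Definition gadget := ((G * bool) + (G * G))%type.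

Definition gadget_adj : rel gadget := fun p q =>
  match p, q with
  | inl (v, _), inr (a, b) => (v == a) && adj a b
  | inr (a, b), inl (v, _) => (v == a) && adj a b
  | inr (a, b), inr (c, d) => [&& a == d, b == c & adj a b]
  | _, _ => false
  end.

Definition gadget_set : {set gadget} :=
  [set p | if p is inr (a, b) then adj a b else true].

Definition gadget_flip (p : gadget) : gadget :=
  match p with inl (v, i) => inl (v, ~~ i) | inr (a, b) => inr (b, a) end.

Lemma gadget_adj_sym : symmetric gadget_adj.
Proof.
move=> [[v i]|[a b]] [[w j]|[c d]] //=.
rewrite (eq_sym c b) (eq_sym d a) [in RHS]andbCA.
have [->|] := eqVneq a d => //=.
by have [->|] := eqVneq b c => //=; rewrite adj_sym.
Qed.

Lemma gadget_flipK : involutive gadget_flip.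
Proof. by move=> [[v i]|[a b]] //=; rewrite negbK. Qed.

Lemma gadget_flip_neq p : p \in gadget_set -> gadget_flip p != p.
Proof.
case: p => [[v i] _|[a b]] /=.
  by apply/eqP => -[]; case: i.
rewrite inE => ab; apply/eqP => -[E _]; move: ab; by rewrite E adj_irr.
Qed.

Lemma gadget_set_even : ~~ odd #|gadget_set|.
Proof.
apply: (@card_involution_even _ gadget_flip) => p pW.
split; [|exact: gadget_flipK|exact: gadget_flip_neq].
by move: pW; case: p => [[v i]|[a b]]; rewrite !inE //= adj_sym.
Qed.

(** In a perfect matching the two copies of x select two darts leaving x; a dart that
    is not selected is matched to its reverse, so the selection is symmetric. *)
Lemma gadget_matching_2factor f :
  matching gadget_adj gadget_set f -> gadget_set \subset covered f ->
  has_2factor G.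
Proof.
move=> /matchingP[ff fW] /subsetP cov.
have fe p : p \in gadget_set -> gadget_adj p (f p).
  by move=> /cov; rewrite inE => /fW[].
pose F : rel G := fun x y => adj x y && (if f (inr (x, y)) is inl _ then true else false).
have Fsub x y : F x y -> F y x.
  move=> /andP[xy]; rewrite /F adj_sym xy /=.
  case E: (f (inr (x, y))) => [q|//] _.
  have: gadget_adj (inr (y, x)) (f (inr (y, x))) by apply: fe; rewrite inE adj_sym.
  case E': (f (inr (y, x))) => [//|[c d]] /= /and3P[/eqP yd /eqP xc _].
  by move: E; rewrite xc yd -E' ff.
exists F; first split.
- by move=> x y; apply/idP/idP => /Fsub.
- by move=> x y /andP[].
move=> x.
have g i : {y | f (inl (x, i)) = inr (x, y) & adj x y}.
  have: gadget_adj (inl (x, i)) (f (inl (x, i))) by apply: fe; rewrite inE.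
  by case: (f _) => [[//]|[a b]] /= /andP[/eqP-> ab]; exists b.
pose h i := s2val (g i).
have hE i : f (inl (x, i)) = inr (x, h i) by rewrite /h; case: (g i).
have ha i : adj x (h i) by rewrite /h; case: (g i).
have -> : [set y | F x y] = h @: [set: bool].
  apply/setP => y; rewrite inE; apply/idP/imsetP.
    move=> /andP[xy].
    have: gadget_adj (inr (x, y)) (f (inr (x, y))) by apply: fe; rewrite inE.
    case E: (f _) => [[v i]|//] /= /andP[/eqP vx _] _.
    by exists i => //; have := hE i; rewrite -vx -E ff => -[].
  by move=> [i _ ->]; rewrite /F ha -hE ff.
rewrite card_imset ?cardsT ?card_bool // => i j hij.
by have := hE i; rewrite hij -hE => /(can_inj ff)[].
Qed.

Definition edges (X Y : {set G}) : {set G * G} :=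
  [set p | [&& p.1 \in X, p.2 \in Y & adj p.1 p.2]].

Lemma card_edgesC X Y : #|edges X Y| = #|edges Y X|.
Proof.
pose s (p : G * G) := (p.2, p.1).
have s_inj : injective s by move=> [a b] [c d] [-> ->].
rewrite -(card_imset _ s_inj); apply: eq_card => -[a b].
apply/imsetP/idP => [[[c d] H [-> ->]]|H].
  by move: H; rewrite !inE /= adj_sym => /and3P[-> ->].
by exists (b, a) => //; move: H; rewrite !inE /= adj_sym => /and3P[-> ->].
Qed.

Lemma card_edges_split X Y :
  #|edges X [set: G]| = #|edges X Y| + #|edges X (~: Y)|.
Proof.
rewrite -(cardsID [set p | p.2 \in Y] (edges X [set: G])).
by congr (_ + _); apply: eq_card => p; rewrite !inE;
   case: (p.1 \in X); case: (p.2 \in Y); rewrite ?andbT ?andbF.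
Qed.

(** The barrier of a graph without 2-factor. The last field is Tutte's inequality
    with the surplus raised to 2 by parity. The edges between T and S are already
    cancelled: as darts leaving T they lie in the barrier of the gadget, and as
    darts leaving S they are isolated odd blocks. By bb_connected the blocks are
    components of G - S - T. *)
Record biased_barrier (S T : {set G}) (P : {set {set G}}) : Prop := BiasedBarrier {
  bb_disjoint : [disjoint S & T];
  bb_indep : {in T &, forall t u, ~~ adj t u};
  bb_blocks : {in P &, forall (C D : {set G}) x, x \in C -> x \in D -> C = D};
  bb_sub : {in P, forall C : {set G}, C \subset ~: (S :|: T)};
  bb_closed : {in P, forall C : {set G}, closed_in (@adj G) (~: (S :|: T)) C};
  bb_connected : {in P, forall C D : {set G}, D \subset C -> D != set0 ->
    closed_in (@adj G) (~: (S :|: T)) D -> D = C};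
  bb_odd : {in P, forall C : {set G}, odd #|edges C T|};
  bb_cover : {in T, forall t x, x \notin S -> adj t x -> x \in cover P};
  bb_uniqT : forall x t u, x \notin S :|: T -> t \in T -> u \in T ->
    adj x t -> adj x u -> t = u;
  bb_uniqC : {in P, forall (C : {set G}) x y t, x \in C -> y \in C -> t \in T ->
    adj x t -> adj y t -> x = y};
  bb_count : 2 * #|S| + #|edges T (~: S)| + 2 <= 2 * #|T| + #|P| }.

Definition full_copies (A : {set gadget}) : {set G} :=
  [set v | (inl (v, true) \in A) && (inl (v, false) \in A)].

(** From an optimal barrier of the gadget to a biased barrier of G. *)
Section FromGadget.

Implicit Types C D : {set gadget}.

Variables (A : {set gadget}) (P : {set {set gadget}}).

Hypothesis AW : A \subset gadget_set.
Hypothesis oP : odd_blocks gadget_adj (gadget_set :\: A) P.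
Hypothesis gapP : #|A| + 2 <= #|P|.
Hypothesis minP : forall C D : {set gadget}, C \in P -> D \subset C -> D != set0 ->
  closed_in gadget_adj (gadget_set :\: A) D -> D = C.
Hypothesis maxS : forall A', #|full_copies A| < #|full_copies A'| ->
  ~~ barrier gadget_adj gadget_set A'.
Hypothesis minA : forall B : {set gadget}, B \subset A -> B != set0 ->
  full_copies (A :\: B) = full_copies A ->
  ~~ barrier gadget_adj gadget_set (A :\: B).

Let X := gadget_set :\: A.
Let e := gadget_adj.

Let blockE (C D : {set gadget}) x : C \in P -> D \in P -> x \in C -> x \in D -> C = D.
Proof. by have [H _] := odd_blocksP _ _ _ oP => CP DP; apply: H. Qed.

Let blockX (C : {set gadget}) x : C \in P -> x \in C -> x \in X.
Proof. by have [_ H] := odd_blocksP _ _ _ oP => /H[/subsetP CX _ _ /CX]. Qed.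

Let blockN (C : {set gadget}) x y : C \in P -> x \in C -> y \in X -> e x y -> y \in C.
Proof.
by have [_ H] := odd_blocksP _ _ _ oP => /H[_ _ /closed_inP cC]; apply: cC.
Qed.

Let pbE (C : {set gadget}) x : C \in P -> x \in C -> pblock P x = C.
Proof. by have /andP[tP _] := oP => CP xC; apply: def_pblock. Qed.

Let pbP x : x \in cover P -> pblock P x \in P /\ x \in pblock P x.
Proof. by move=> xP; rewrite pblock_mem // mem_pblock. Qed.

Let many_blocks (B N : {set gadget}) : B \subset A -> B != set0 ->
  full_copies (A :\: B) = full_copies A ->
  (forall x y, x \in B -> y \in X -> e x y -> y \in N) ->
  #|B| + 1 < #|pblock P @: (N :&: cover P)|.
Proof.
move=> BA B0 SB NB; rewrite ltnNge; apply: contra (minA BA B0 SB).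
exact: (barrier_shrink gadget_adj_sym oP).
Qed.

Let inj_blocks (N : {set gadget}) k : #|N| <= k ->
  k <= #|pblock P @: (N :&: cover P)| ->
  N \subset cover P /\ {in N &, injective (pblock P)}.
Proof.
move=> Nk kN.
have le1 := leq_imset_card (pblock P) (N :&: cover P).
have le2 := subset_leq_card (subsetIl N (cover P)).
have E : N :&: cover P = N.
  by apply/eqP; rewrite eqEcard subsetIl (leq_trans Nk) // (leq_trans kN).
split; first by rewrite -E subsetIr.
apply/imset_injP; rewrite eqn_leq leq_imset_card.
by rewrite -{2}E (leq_trans Nk).
Qed.

(** A dart of A has only three neighbours, and by minimality of A it sees at least three
    blocks; so the two copies and the reverse dart lie in distinct blocks. *)
Let dart_blocks a b : inr (a, b) \in A ->
  let N := [set inl (a, true); inl (a, false); inr (b, a)] in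
  N \subset cover P /\ {in N &, injective (pblock P)}.
Proof.
move=> abA N; have ab : adj a b by have := subsetP AW _ abA; rewrite inE.
apply: (@inj_blocks N 3).
  by rewrite /N -!setUA !cardsU1 cards1; do 2!case: (_ \notin _).
have <- : #|[set (inr (a, b) : gadget)]| + 2 = 3 by rewrite cards1.
rewrite addn2 -addn1; apply: many_blocks.
- by rewrite sub1set.
- by apply/set0Pn; exists (inr (a, b)); rewrite inE.
- by apply/setP => v; rewrite !inE.
move=> x y; rewrite inE => /eqP->; case: y => [[v i]|[c d]] /= _.
  by move=> /andP[/eqP-> _]; rewrite /N !inE; case: i; rewrite ?eqxx ?orbT.
by move=> /and3P[/eqP<- /eqP<- _]; rewrite /N !inE eqxx ?orbT.
Qed.


Let S := full_copies A.

Let T : {set G} :=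
  [set v | (v \notin S) && [forall w, adj v w ==> (inr (v, w) \in A)]].

Let e_copy_dart a b i : adj a b -> e (inl (a, i)) (inr (a, b)).
Proof. by move=> ab; rewrite /e /= eqxx. Qed.

Let e_dart_copy a b i : adj a b -> e (inr (a, b)) (inl (a, i)).
Proof. by move=> ab; rewrite /e /= eqxx. Qed.

Let e_dart_dart a b : adj a b -> e (inr (a, b)) (inr (b, a)).
Proof. by move=> ab; rewrite /e /= !eqxx. Qed.

Let coverX x : x \in cover P -> x \in X.
Proof. by move=> /pbP[pP xp]; apply: blockX xp. Qed.

Let XA x : x \in X -> x \notin A.
Proof. by rewrite inE => /andP[]. Qed.

(** A dart (a,c) outside A would join the two copies of a, which lie in distinct
    blocks. *)
Let dart_in_A a b : inr (a, b) \in A ->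
  [/\ forall i, inl (a, i) \notin A, inr (b, a) \notin A &
      forall c, adj a c -> inr (a, c) \in A].
Proof.
move=> abA; have [/subsetP NP pbI] := dart_blocks abA.
have aP i : inl (a, i) \in cover P.
  by apply: NP; rewrite !inE; case: i; rewrite ?eqxx ?orbT.
split.
- by move=> i; apply/XA/coverX.
- by apply/XA/coverX/NP; rewrite !inE eqxx ?orbT.
move=> c ac; apply/negPn/negP => acA.
have acX : inr (a, c) \in X by rewrite !inE acA.
have mem i : inr (a, c) \in pblock P (inl (a, i)).
  by have [pP xp] := pbP (aP i); apply: (blockN pP xp acX (e_copy_dart i ac)).
have pbP1 i := (pbP (aP i)).1.
have := blockE (pbP1 true) (pbP1 false) (mem true) (mem false).
by move=> E; have := pbI _ _ _ _ E; rewrite !inE !eqxx ?orbT => /(_ isT isT) [].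
Qed.

(** If the other copy were outside A, all darts leaving a that belong to a block
    would belong to the block of that copy, so the copy in A would see one block
    only and could be removed. *)
Let copy_in_A a i : inl (a, i) \in A -> a \in S.
Proof.
move=> aA; apply/negPn/negP => aS.
have a'A : inl (a, ~~ i) \notin A.
  by apply: contra aS => a'A; rewrite inE; case: i aA a'A => /= -> ->.
have a'X : inl (a, ~~ i) \in X by rewrite !inE a'A.
pose B := [set (inl (a, i) : gadget)].
have BA : B \subset A by rewrite sub1set.
have B0 : B != set0 by apply/set0Pn; exists (inl (a, i)); rewrite inE.
have SB : full_copies (A :\: B) = full_copies A.
  apply/setP => v; move: aS; rewrite !inE.
  have [->|va] := eqVneq v a.
    by case: i aA a'A a'X @B BA B0 => /= -> /negPf->; rewrite ?andbF.
  by rewrite !(inj_eq (@inl_inj _ _)) !xpair_eqE (negPf va).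
pose N := [set q in X | e (inl (a, i)) q].
have NB x y : x \in B -> y \in X -> e x y -> y \in N.
  by rewrite inE => /eqP-> yX exy; rewrite inE yX.
have := many_blocks BA B0 SB NB; rewrite cards1 ltnNge => /negP; apply.
apply: (@leq_trans 1) => //; rewrite -(cards1 (pblock P (inl (a, ~~ i)))).
apply: subset_leq_card; apply/subsetP => C /imsetP[q /setIP[qN /pbP[pP qp]] ->].
move: qN => /setIdP[qX].
case: q qX pP qp => [[v j]//|[c d]] qX pP qp /andP[/eqP ac cd].
rewrite inE eq_sym; apply/eqP/pbE => //; apply: (blockN pP qp a'X).
by rewrite ac; apply: e_dart_copy.
Qed.

Let copyX v i : v \notin S -> inl (v, i) \in X.
Proof. by move=> vS; rewrite !inE andbT; apply: contra vS => /copy_in_A. Qed.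

Let dart_in_T a b : inr (a, b) \in A -> a \in T.
Proof.
move=> abA; have [aA _ H] := dart_in_A abA; rewrite inE; apply/andP; split.
  by rewrite inE (negPf (aA true)).
by apply/forallP => w; apply/implyP/H.
Qed.

Let T_dart a b : a \in T -> adj a b -> inr (a, b) \in A.
Proof. by rewrite inE => /andP[_ /forallP/(_ b)/implyP]. Qed.

Let dartX a b : a \notin T -> adj a b -> inr (a, b) \in X.
Proof. by move=> aT ab; rewrite !inE ab andbT; apply: contra aT => /dart_in_T. Qed.

Let T_notin_S a : a \in T -> a \notin S.
Proof. by rewrite inE => /andP[]. Qed.

Let T_indep : {in T &, forall t u, ~~ adj t u}.
Proof.
move=> t u tT uT; apply/negP => tu; have := T_dart tT tu => /dart_in_A[_ + _].
by rewrite T_dart // adj_sym.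
Qed.

(** The isolated points of the gadget outside A. A block meeting Z is a singleton; the
    other blocks correspond to the odd components of G - S - T. *)
Let Z : {set gadget} :=
  [set p | match p with inl (v, _) => v \in T
           | inr (a, b) => [&& a \in S, b \in T & adj a b] end].

Let Z_isolated C z : C \in P -> z \in C -> z \in Z -> C = [set z].
Proof.
move=> CP zC zZ; apply/esym; apply: minP => //.
- by rewrite sub1set.
- by apply/set0Pn; exists z; rewrite inE.
apply/closed_inP => x y /set1P-> /XA yA.
case: z zZ {zC} => [[v i]|[a b]]; rewrite inE.
  move=> vT; case: y yA => [[//]|[c d]] yA /= /andP[/eqP vc cd].
  by move: yA; rewrite T_dart // -vc.
move=> /and3P[aS bT ab]; case: y yA => [[v i]|[c d]] yA /=.
  move=> /andP[/eqP va _]; move: yA; rewrite va.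
  by move: aS; rewrite inE => /andP[a1 a2]; case: i; rewrite ?a1 ?a2.
move=> /and3P[/eqP ad /eqP bc _]; move: yA; rewrite -ad -bc.
by rewrite T_dart // adj_sym.
Qed.

Let PU : {set {set gadget}} := [set C in P | [disjoint C & Z]].

Let PUP C : C \in PU -> C \in P /\ forall z, z \in C -> z \notin Z.
Proof.
rewrite inE => /andP[CP /pred0P dC]; split=> // z zC; apply/negP => zZ.
by have := dC z; rewrite /= zC zZ.
Qed.

Let base (C : {set gadget}) : {set G} := [set u | inl (u, true) \in C].

Let base_U C u : C \in PU -> u \in base C -> u \notin S :|: T.
Proof.
move=> /PUP[CP CZ]; rewrite inE => uC; rewrite inE negb_or.
have := CZ _ uC; rewrite [_ \in Z]inE => ->; rewrite andbT.
by apply: contra (XA (blockX CP uC)); rewrite inE => /andP[].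
Qed.

Let base_T C u : C \in PU -> u \in base C -> u \notin T.
Proof. by move=> CP /(base_U CP); rewrite inE negb_or => /andP[]. Qed.

Let base_copy C u i : C \in PU -> inl (u, i) \in C -> inl (u, ~~ i) \in C.
Proof.
move=> CPU uC; have [CP CZ] := PUP CPU.
have uT : u \notin T by have := CZ _ uC; rewrite inE.
have uS : u \notin S.
  apply: contra (XA (blockX CP uC)); rewrite inE.
  by case: i {uC} => /andP[].
have: ~~ [forall w, adj u w ==> (inr (u, w) \in A)].
  by apply: contra uT => H; rewrite inE uS.
move=> /forallPn[w]; rewrite negb_imply => /andP[uw uwA].
have uwX : inr (u, w) \in X by apply: dartX.
have uwC := blockN CP uC uwX (e_copy_dart i uw).
exact: (blockN CP uwC (copyX _ uS) (e_dart_copy _ uw)).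
Qed.

Let base_dart C u w : C \in PU -> u \in base C -> adj u w -> inr (u, w) \in C.
Proof.
move=> CPU uC uw; have [CP _] := PUP CPU; have uT := base_T CPU uC.
by move: uC; rewrite inE => uC; apply: (blockN CP uC (dartX uT uw) (e_copy_dart _ uw)).
Qed.

Let dart_base C u w : C \in PU -> u \notin S -> inr (u, w) \in C -> u \in base C.
Proof.
move=> CPU uS uC; have [CP _] := PUP CPU; rewrite inE.
have uw : adj u w by have := blockX CP uC; rewrite !inE => /andP[].
exact: (blockN CP uC (copyX _ uS) (e_dart_copy _ uw)).
Qed.

Let base_closed C : C \in PU -> closed_in (@adj G) (~: (S :|: T)) (base C).
Proof.
move=> CPU; apply/closed_inP => u w uC; rewrite in_setC in_setU negb_or => /andP[wS wT] uw.
have [CP _] := PUP CPU; have uwC := base_dart CPU uC uw.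
have wu : adj w u by rewrite adj_sym.
have wuC := blockN CP uwC (dartX wT wu) (e_dart_dart uw).
exact: (dart_base CPU wS wuC).
Qed.

(** Reversing darts and exchanging copies pairs off the points of C, except the
    darts from the base to T, whose reverses belong to A. *)
Let base_odd C : C \in PU -> odd #|edges (base C) T|.
Proof.
move=> CPU; have [CP CZ] := PUP CPU.
pose E : {set gadget} := [set inr p | p in edges (base C) T].
have cE : #|E| = #|edges (base C) T| by apply: card_imset; apply: inr_inj.
have EC : E \subset C.
  apply/subsetP => _ /imsetP[[a b] ab ->].
  by move: ab; rewrite inE => /and3P[/= aC _ ab]; apply: base_dart.
have oC : odd #|C| by have [_ H] := odd_blocksP _ _ _ oP; have [] := H C CP.
rewrite -cE; move: oC; rewrite -(cardsID E C) (setIidPr EC) oddD.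
suff /negPf-> : ~~ odd #|C :\: E| by rewrite addbF.
apply: (@card_involution_even _ gadget_flip) => p /setDP[pC pE].
have pX := blockX CP pC.
split; [|exact: gadget_flipK|]; last first.
  by apply: gadget_flip_neq; move: pX; rewrite inE => /andP[].
case: p pC pE pX => [[v i]|[a b]] pC pE pX.
  by apply/setDP; split; [exact: base_copy | apply/imsetP => -[]].
have ab : adj a b by move: pX; rewrite !inE => /andP[].
have aT : a \notin T by apply: contra (XA pX) => /T_dart ->.
have bT : b \notin T.
  apply: contra pE => bT; apply/imsetP; exists (a, b) => //.
  rewrite [_ \in _]inE /= bT ab (dart_base CPU _ pC) //.
  by have := CZ _ pC; rewrite [_ \in Z]inE bT ab /= andbT.
have ba : adj b a by rewrite adj_sym.
apply/setDP; split; first exact: (blockN CP pC (dartX bT ba) (e_dart_dart ab)).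
apply/imsetP => -[[c d]]; rewrite inE => /and3P[/= _ dT _] [_ ad].
by move: aT; rewrite ad dT.
Qed.

Let base_inj C D u : C \in PU -> D \in PU -> u \in base C -> u \in base D -> C = D.
Proof.
move=> /PUP[CP _] /PUP[DP _]; rewrite inE => uC; rewrite inE => uD.
exact: blockE CP DP uC uD.
Qed.

Let base_connected C (D : {set G}) : C \in PU -> D \subset base C -> D != set0 ->
  closed_in (@adj G) (~: (S :|: T)) D -> D = base C.
Proof.
move=> CPU DC /set0Pn[v vD] /closed_inP cD; have [CP _] := PUP CPU.
pose E : {set gadget} := [set p in C | match p with inl (u, _) => u \in D
                                  | inr (a, b) => (a \in D) || (b \in D) end].
have EC : E = C.
  apply: minP => //.
  - by apply/subsetP => p; rewrite inE => /andP[].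
  - apply/set0Pn; exists (inl (v, true)); rewrite inE vD andbT.
    by have := subsetP DC _ vD; rewrite inE.
  apply/closed_inP => p q /setIdP[pC pD] qX epq.
  have pX := blockX CP pC.
  rewrite inE (blockN CP pC qX epq) /=.
  case: p q pC pD qX epq pX => [[u i]|[a b]] [[w j]|[c d]] //= pC pD qX.
    by move=> /andP[/eqP<- _]; rewrite pD.
    move=> /andP[/eqP wa ab] pX; rewrite wa; case/orP: pD => // bD.
    apply: cD bD _ _; last by rewrite adj_sym.
    rewrite in_setC in_setU negb_or; apply/andP; split.
      apply: contra (XA qX); rewrite wa inE => /andP[a1 a2].
      by case: (j).
    by apply: contra (XA pX) => aT; apply: T_dart.
  by move=> /and3P[/eqP<- /eqP<- _] _; rewrite orbC.
apply/eqP; rewrite eqEsubset DC /=; apply/subsetP => u.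
by rewrite inE -{1}EC inE => /andP[].
Qed.

(** Otherwise both copies of x can be added to A: at most one block is lost, and
    the darts (x,t) and (x,u) become two new singleton blocks. This uses up one
    unit of the surplus 2, and contradicts the maximality of S. *)
Let T_neighbour_unique x t u : x \notin S :|: T -> t \in T -> u \in T ->
  adj x t -> adj x u -> t = u.
Proof.
rewrite in_setU negb_or => /andP[xS xT] tT uT xt xu; apply/eqP/negPn/negP => tu.
pose A' := A :|: [set inl (x, true); inl (x, false)].
have A'E p : (p \in A') = (p \in A) || (p \in [set inl (x, true); inl (x, false)]).
  by rewrite in_setU.
have xA' i : inl (x, i) \in A' by rewrite A'E !inE; case: i; rewrite eqxx ?orbT.
have AA' : A \subset A' by apply: subsetUl.
have A'W : A' \subset gadget_set.
  by rewrite subUset AW; apply/subsetP => p /set2P[]->; rewrite inE.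
have X'X : gadget_set :\: A' \subset X by apply: setDS.
pose C0 := pblock P (inr (x, t)).
have xtX := dartX xT xt; have xuX := dartX xT xu.
have xC C i : C \in P :\ C0 -> inl (x, i) \notin C.
  move=> /setD1P[CC0 CP]; apply: contra CC0 => xC.
  by apply/eqP/esym/pbE => //; apply: blockN CP xC xtX (e_copy_dart i xt).
have dC C w : C \in P :\ C0 -> adj x w -> inr (x, w) \notin C.
  move=> CP xw; apply: contra (xC C true CP) => xwC.
  by have /setD1P[_ CP'] := CP; apply: (blockN CP' xwC (copyX _ xS) (e_dart_copy _ xw)).
have oP0 : odd_blocks e (gadget_set :\: A') (P :\ C0).
  apply/odd_blocksP; split.
    by move=> C D /setD1P[_ CP] /setD1P[_ DP] p; apply: blockE.
  move=> C CP0; have /setD1P[_ CP] := CP0.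
  have [_ H] := odd_blocksP _ _ _ oP; have [CX oC cC] := H C CP; split=> //.
    apply/subsetP => p pC; have := blockX CP pC; rewrite !in_setD A'E negb_or => /andP[-> ->].
    rewrite andbT; apply/negP => /set2P[] E; move: pC; rewrite E; apply/negP; exact: xC.
  apply/closed_inP => p q pC /(subsetP X'X) qX; exact: blockN.
have single w : w \in T -> adj x w -> [set (inr (x, w) : gadget)] \subset gadget_set :\: A'
    /\ closed_in e (gadget_set :\: A') [set inr (x, w)].
  move=> wT xw; split.
    rewrite sub1set in_setD A'E !inE xw andbT orbF.
    by apply: contra xT => /dart_in_T.
  apply/closed_inP => p q /set1P-> ; rewrite in_setD => /andP[qA' _].
  case: q qA' => [[v i]|[c d]] qA' /= => [/andP[/eqP vx _]|/and3P[/eqP xd /eqP wc _]].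
    by move: qA'; rewrite vx xA'.
  by move: qA'; rewrite -xd -wc (subsetP AA') // T_dart // adj_sym.
have disj w (Q : {set {set gadget}}) : (forall C, C \in Q -> inr (x, w) \notin C) ->
    [disjoint [set (inr (x, w) : gadget)] & cover Q].
  move=> H; apply/pred0P => p /=; apply/negP => /andP[/set1P-> /bigcupP[C CQ xwC]].
  by move: (H C CQ); rewrite xwC.
have [xuX' cxu] := single u uT xu; have [xtX' cxt] := single t tT xt.
have odd1 w : odd #|[set (inr (x, w) : gadget)]| by rewrite cards1.
have [oP1 nP1] := odd_blocksU1 oP0 xuX' (odd1 u) cxu (disj u _ (fun C CP => dC C u CP xu)).
have [|oP2 nP2] := odd_blocksU1 oP1 xtX' (odd1 t) cxt.
  apply: disj => C /setU1P[->|CP]; last exact: dC.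
  by rewrite inE; apply/eqP => -[E]; rewrite E eqxx in tu.
suff /maxS/negP[] : #|full_copies A| < #|full_copies A'|.
  rewrite /barrier A'W; apply/existsP; exists ([set inr (x, t)] |: ([set inr (x, u)] |: P :\ C0)).
  rewrite oP2 /= cardsU1 nP2 cardsU1 nP1 /=.
  have := cardsU A [set inl (x, true); inl (x, false)]; rewrite -/A' cards2.
  have := cardsD1 C0 P; have := leq_b1 (C0 \in P); move: gapP.
  have arith a a' c i b p q : a + 2 <= p -> b <= 1 -> p = b + q -> a' = a + (c.+1) - i -> c <= 1 ->
     a' < 1 + (1 + q) by clear; lia.
  move=> h1 h2 h3 h4; apply: arith h1 h2 h3 h4 _; exact: leq_b1.
apply: proper_card; apply/properP; split.
  by apply/subsetP => v; rewrite !inE => /andP[-> ->].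
by exists x; rewrite // inE !xA'.
Qed.

(** Otherwise the darts (t,x) and (t,y) together see at most three blocks: those of
    the two copies of t, and C. So both could be removed from A. *)
Let base_neighbour_unique C x y t : C \in PU -> x \in base C -> y \in base C ->
  t \in T -> adj x t -> adj y t -> x = y.
Proof.
move=> CPU xC yC tT xt yt; apply/eqP/negPn/negP => xy.
have [CP _] := PUP CPU.
pose B : {set gadget} := [set inr (t, x); inr (t, y)].
pose N : {set gadget} := [set inl (t, true); inl (t, false); inr (x, t); inr (y, t)].
have BA : B \subset A.
  by apply/subsetP => p /set2P[]->; apply: T_dart; rewrite // adj_sym.
have B0 : B != set0 by apply/set0Pn; exists (inr (t, x)); rewrite !inE eqxx.
have SB : full_copies (A :\: B) = full_copies A.
  by apply/setP => v; rewrite !inE.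
have NB p q : p \in B -> q \in X -> e p q -> q \in N.
  move=> pB _; have {pB} [w pE wxy] : exists2 w, p = inr (t, w) & w = x \/ w = y.
    by move: pB => /set2P[]->; [exists x | exists y]; auto.
  rewrite pE; case: q => [[v i]|[c d]] /=.
    by move=> /andP[/eqP-> _]; rewrite !inE; case: i; rewrite eqxx ?orbT.
  by move=> /and3P[/eqP<- /eqP<- _]; case: wxy => ->; rewrite !inE eqxx ?orbT.
have := many_blocks BA B0 SB NB; rewrite ltnNge => /negP; apply.
have -> : #|B| + 1 = 3.
  by rewrite cards2 (inj_eq (@inr_inj _ _)) xpair_eqE eqxx (negPf xy).
pose K := [set pblock P (inl (t, true)); pblock P (inl (t, false)); C].
apply: (@leq_trans #|K|); last first.
  by rewrite /K -!setUA !cardsU1 cards1; do 2!case: (_ \notin _).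
apply: subset_leq_card; apply/subsetP => D /imsetP[q /setIP[qN _] ->].
move: qN; rewrite /N -!setUA => /setU1P[->|/setU1P[->|/set2P[]->]].
- by rewrite !inE eqxx.
- by rewrite !inE eqxx orbT.
- by rewrite (pbE CP (base_dart CPU xC xt)) !inE eqxx !orbT.
- by rewrite (pbE CP (base_dart CPU yC yt)) !inE eqxx !orbT.
Qed.

Let base_cover t x : t \in T -> x \notin S -> adj t x -> x \in cover (base @: PU).
Proof.
move=> tT xS tx; have xT : x \notin T.
  by apply: contraL tx => xT; apply: T_indep.
have [/subsetP NP _] := dart_blocks (T_dart tT tx).
have /pbP[CP xtC] : inr (x, t) \in cover P.
  by apply: NP; rewrite !inE eqxx ?orbT.
have xt : adj x t by rewrite adj_sym.
have xC := blockN CP xtC (copyX true xS) (e_dart_copy _ xt).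
apply/bigcupP; exists (base (pblock P (inr (x, t)))); last by rewrite inE.
apply: imset_f; rewrite inE CP /=; apply/pred0P => z /=; apply/negP => /andP[zC zZ].
by move: xC xtC; rewrite (Z_isolated CP zC zZ) => /set1P<- /set1P.
Qed.

Let base_nonempty C : C \in PU -> exists u, u \in base C.
Proof.
move=> CPU; have: edges (base C) T != set0.
  by apply: contraTneq (base_odd CPU) => ->; rewrite cards0.
by move=> /set0Pn[[u t]]; rewrite inE => /and3P[uC _ _]; exists u.
Qed.

Let count_A : 2 * #|S| + #|edges T [set: G]| <= #|A|.
Proof.
pose A1 : {set gadget} := inl @: setX S [set: bool].
pose A2 : {set gadget} := inr @: edges T [set: G].
have c1 : #|A1| = 2 * #|S|.
  by rewrite card_imset ?cardsX ?cardsT ?card_bool 1?mulnC //; apply: inl_inj.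
have c2 : #|A2| = #|edges T [set: G]| by apply/card_imset/inr_inj.
have d : A1 :&: A2 = set0.
  by apply/eqP; rewrite -subset0; apply/subsetP => p /setIP[/imsetP[q _ ->] /imsetP[]].
rewrite -c1 -c2 -[_ + _]subn0 -(cards0 gadget) -d -cardsU.
apply: subset_leq_card; rewrite subUset; apply/andP; split.
  apply/subsetP => _ /imsetP[[s i] /setXP[/= sS _] ->].
  by move: sS; rewrite inE => /andP[a1 a2]; case: i.
apply/subsetP => _ /imsetP[[a b] + ->].
by rewrite inE => /and3P[/= aT _ ab]; apply: T_dart.
Qed.

Let count_Z : #|Z| <= 2 * #|T| + #|edges S T|.
Proof.
have -> : 2 * #|T| = #|(inl @: setX T [set: bool] : {set gadget})|.
  by rewrite card_imset ?cardsX ?cardsT ?card_bool 1?mulnC //; apply: inl_inj.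
have -> : #|edges S T| = #|(inr @: edges S T : {set gadget})|.
  by apply/esym/card_imset/inr_inj.
apply: leq_trans (leq_card_setU _ _); apply: subset_leq_card; apply/subsetP => p.
rewrite [_ \in Z]inE in_setU; case: p => [[v i] vT|[a b] abZ]; apply/orP.
  by left; apply: imset_f; rewrite in_setX vT inE.
by right; apply: imset_f; rewrite inE.
Qed.

Let count : 2 * #|S| + #|edges T (~: S)| + 2 <= 2 * #|T| + #|base @: PU|.
Proof.
have cPU : #|base @: PU| = #|PU|.
  apply: card_in_imset => C D CPU DPU E; have [u uC] := base_nonempty CPU.
  by apply: (base_inj CPU DPU uC); rewrite -E.
have cE : #|edges T [set: G]| = #|edges S T| + #|edges T (~: S)|.
  by rewrite (card_edgesC S) (card_edges_split T S).
have cP : #|P| <= #|PU| + #|Z|.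
  rewrite -(cardsID [set C : {set gadget} | [disjoint C & Z]] P).
  apply: leq_add; first by apply: subset_leq_card; apply/subsetP => C; rewrite !inE.
  apply: leq_trans (leq_imset_card (pblock P) Z); apply: subset_leq_card.
  apply/subsetP => C /setDP[CP]; rewrite inE => /pred0Pn[z /andP[zC zZ]].
  by apply/imsetP; exists z; rewrite // (pbE CP zC).
move: count_A count_Z gapP; rewrite cPU cE; move: cP; clear.
have arith a s t est ets p pu z : p <= pu + z -> 2 * s + (est + ets) <= a -> z <= 2 * t + est ->
  a + 2 <= p -> 2 * s + ets + 2 <= 2 * t + pu by lia.
exact: arith.
Qed.

Lemma biased_barrier_of_gadget : exists S T P, biased_barrier S T P.
Proof.
exists S, T, (base @: PU); split.
- by apply/pred0P => v /=; apply/negP => /andP[vS /T_notin_S]; rewrite vS.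
- exact: T_indep.
- move=> _ _ /imsetP[C CPU ->] /imsetP[D DPU ->] u uC uD.
  by rewrite (base_inj CPU DPU uC uD).
- move=> _ /imsetP[C CPU ->]; apply/subsetP => u uC.
  by rewrite in_setC (base_U CPU uC).
- by move=> _ /imsetP[C CPU ->]; apply: base_closed.
- by move=> _ /imsetP[C CPU ->] D; apply: base_connected.
- by move=> _ /imsetP[C CPU ->]; apply: base_odd.
- by move=> t tT x; apply: base_cover.
- exact: T_neighbour_unique.
- by move=> _ /imsetP[C CPU ->] x y t; apply: base_neighbour_unique.
- exact: count.
Qed.

End FromGadget.

(** The barrier is chosen with the largest S and, subject to that, of the smallest
    size; both criteria are used, for T_neighbour_unique and for the lemmas that
    remove points. *)
Lemma has_2factor_or_biased_barrier :
  has_2factor G \/ exists S T P, biased_barrier S T P.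
Proof.
pose e := gadget_adj; pose W := gadget_set.
have [/existsP[f /andP[Mf cov]]|/existsPn noPM] :=
    boolP [exists f : {ffun gadget -> gadget}, matching e W f && (W \subset covered f)].
  by left; apply: gadget_matching_2factor Mf cov.
right.
have [A0 [P0 [A0W oP0 gap0]]] : exists (A : {set gadget}) P,
    [/\ A \subset W, odd_blocks e (W :\: A) P & #|A| + 1 <= #|P|].
  apply: (tutte_berge gadget_adj_sym) => f Mf; rewrite card_gt0 setD_eq0.
  by have := noPM f; rewrite Mf.
have bA0 : barrier e W A0.
  by apply/barrierP; split=> //; exists P0; rewrite // -addn1.
pose M := #|{: gadget}|.
(* This number encodes the lexicographic order, since the second term is at most M. *)
pose score (A : {set gadget}) := #|full_copies A| * M.+1 + (M - #|A|).
case: (arg_maxnP score bA0) => A bA maxA.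
have [AW _] := barrierP _ _ _ bA.
have [P1 oP1 gap1] := barrier_gap gadget_adj_sym gadget_set_even bA.
have [P [oP cP minP]] := exists_connected_blocks gadget_adj_sym oP1.
apply: (@biased_barrier_of_gadget A P) => //; first by rewrite cP.
  move=> A' ltS; apply: contraTN ltS => /maxA; rewrite -leqNgt /score => le.
  have leM : M - #|A| <= M by apply: leq_subr.
  rewrite leqNgt; apply/negP => lt.
  have arith m x y a a' : m.+1 + x <= y -> y + a' <= x + a -> a <= m -> False.
    by clear; lia.
  have := leq_mul lt (leqnn M.+1); rewrite mulSn => le'.
  exact: arith le' le leM.
move=> B BA B0 SB; apply/negP => /maxA /=; rewrite /score SB leq_add2l.
have := cardsID B A; rewrite (setIidPr BA); have := max_card (mem A).
move: B0; rewrite -card_gt0.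
have arith m a b d : 0 < b -> a <= m -> b + d = a -> m - d <= m - a -> False.
  by clear; lia.
exact: arith.
Qed.

End Gadget.

(** * Connectivity and toughness through labellings *)

Section Separation.

Variable G : sgraph.

Implicit Types (S I : {set G}).

(** Labellings that are constant along the edges of G - S: they bound the number of
    components of G - S from below without any mention of paths. *)
Definition separating (K : eqType) S (g : G -> K) :=
  forall x y, x \notin S -> y \notin S -> adj x y -> g x = g y.

Let delete_connect_sym S : connect_sym (@adj (delete S)).
Proof. exact: sym_connect_sym (@adj_sym (delete S)). Qed.

Lemma connect_delete_label (K : eqType) S (g : G -> K) (x y : delete S) :
  separating S g -> connect (@adj (delete S)) x y -> g (val x) = g (val y).
Proof.
move=> gS /connectP[p]; elim: p x => [|z p IHp] x /=; first by move=> _ ->.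
move=> /andP[xz zp] yE; rewrite -(IHp z zp yE); apply: gS => //.
  by have := valP x; rewrite inE.
by have := valP z; rewrite inE.
Qed.

Lemma connected_delete_label (K : eqType) S (g : G -> K) x y :
  connected (delete S) -> separating S g -> x \notin S -> y \notin S -> g x = g y.
Proof.
move=> /eqP con gS xS yS.
have xS' : x \in ~: S by rewrite inE.
have yS' : y \in ~: S by rewrite inE.
pose x' : delete S := Sub x xS'; pose y' : delete S := Sub y yS'.
suff: connect (@adj (delete S)) x' y' by apply: connect_delete_label.
apply/(fingraph.rootP (@delete_connect_sym S)).
have le1 : #|predI (roots (@adj (delete S))) (mem [set: delete S])| <= 1.
  by move: con; rewrite /num_comp /n_comp_mem => ->.
by apply: (card_le1_eqP le1); rewrite !inE (roots_root (@delete_connect_sym S)).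
Qed.

Lemma num_comp_delete_label (K : eqType) S I (g : G -> K) :
  separating S g -> [disjoint I & S] -> {in I &, injective g} ->
  #|I| <= num_comp (delete S).
Proof.
move=> gS dIS gI.
have IS x : x \in I -> x \in ~: S by move=> xI; rewrite inE (disjointFr dIS xI).
pose J : {set delete S} := [set z | val z \in I].
have cJ : #|J| = #|I|.
  rewrite -(card_imset (mem J) val_inj); apply: eq_card => x.
  apply/imsetP/idP => [[z + ->]|xI]; first by rewrite inE.
  by exists (Sub x (IS x xI)); rewrite // inE.
pose r := fingraph.root (@adj (delete S)).
have r_inj : {in J &, injective r}.
  move=> x y; rewrite !inE => xI yI.
  move=> /(fingraph.rootP (@delete_connect_sym S))/(connect_delete_label gS)/(gI _ _ xI yI).
  exact: val_inj.
rewrite -cJ -(card_in_imset r_inj); apply: subset_leq_card.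
by apply/subsetP => _ /imsetP[z _ ->]; rewrite !inE (roots_root (@delete_connect_sym S)).
Qed.

Lemma tough1_label (K : eqType) S I (g : G -> K) :
  tough 1 G -> separating S g -> [disjoint I & S] -> {in I &, injective g} ->
  1 < #|I| -> #|I| <= #|S|.
Proof.
move=> tG gS dIS gI I2; have cI := num_comp_delete_label gS dIS gI.
have cut : vertex_cut S by apply: leq_trans cI.
apply: leq_trans cI _; move: tG; rewrite /tough /toughness.
case: ifP => [/forallP cG _|_ le].
  have [x [y [xI yI xy]]] : exists x y, [/\ x \in I, y \in I & x != y].
    by have /card_gt1P[x [y [? ? ?]]] := I2; exists x, y.
  have xyadj : adj x y by have /forallP/(_ y)/implyP/(_ xy) := cG x.
  case/eqP: xy; apply: gI => //; apply: gS => //.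
    by rewrite (disjointFr dIS xI).
  by rewrite (disjointFr dIS yI).
have := Order.POrderTheory.le_trans le (Order.TotalTheory.bigmin_le_cond _ _ cut).
rewrite lee_fin Num.Theory.ler_pdivlMr ?Num.Theory.ltr0n; last exact: ltnW cut.
by rewrite GRing.mul1r Num.Theory.ler_nat.
Qed.

End Separation.

(** * Induced linear forests *)

Lemma embedding_not_free (H G : sgraph) (h : H -> G) :
  injective h -> {mono h : x y / adj x y} -> ~ induced_free H G.
Proof.
move=> h_inj h_mono; apply; pose A : {set G} := [set h x | x in [set: H]].
have hA x : h x \in A by apply: imset_f.
pose g x : induced A := Sub (h x) (hA x).
have g_inj : injective g by move=> x y /(congr1 val) /h_inj.
have [|f gK fK] := inj_card_bij g_inj.
  by rewrite card_sig -cardsT; apply: leq_imset_card.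
exists A, f; first by exists g.
by move=> a b; rewrite -[in RHS](fK a) -[in RHS](fK b) -h_mono.
Qed.

Lemma induced_free_embedding (H H' G : sgraph) (j : H -> H') :
  injective j -> {mono j : x y / adj x y} -> induced_free H G -> induced_free H' G.
Proof.
move=> j_inj j_mono freeH [A [f [f' fK f'K] f_mono]].
apply: (@embedding_not_free H G (fun x => val (f' (j x)))) freeH.
  by move=> x y /val_inj /(can_inj f'K) /j_inj.
by move=> x y; rewrite -j_mono -[in RHS](f'K (j x)) -[in RHS](f'K (j y)) f_mono.
Qed.

Lemma path_and_independent_not_free n k (G : sgraph) (p : 'I_n -> G) (I : {set G}) :
  injective p -> (forall i j, adj (p i) (p j) = path_adj i j) -> k <= #|I| ->
  {in I &, forall x y, ~~ adj x y} ->
  (forall i x, x \in I -> (p i != x) && ~~ adj (p i) x) ->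
  ~ induced_free (disjoint_union (path_graph n) (copies k (path_graph 1))) G.
Proof.
move=> p_inj p_adj kI I_indep pI.
pose q (j : 'I_k) : G := enum_val (widen_ord kI j).
have qI j : q j \in I by apply: enum_valP.
have q_inj : injective q by move=> i j /enum_val_inj [] /ord_inj.
pose h (v : disjoint_union (path_graph n) (copies k (path_graph 1))) : G :=
  match v with inl i => p i | inr (j, _) => q j end.
apply: (@embedding_not_free _ _ h).
  move=> [i|[i u]] [j|[j v]] /=.
  - by move=> /p_inj ->.
  - by move=> E; have := pI i _ (qI j); rewrite E eqxx.
  - by move=> E; have := pI j _ (qI i); rewrite E eqxx.
  - by move=> /q_inj ->; rewrite (ord1 u) (ord1 v).
move=> [i|[i u]] [j|[j v]] /=.
- exact: p_adj.
- by have /andP[_ /negPf] := pI i _ (qI j).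
- by rewrite adj_sym; have /andP[_ /negPf] := pI j _ (qI i).
- by rewrite (negPf (I_indep _ _ (qI i) (qI j))) /copies_adj (ord1 u) (ord1 v) adj_irr andbF.
Qed.

Lemma adj_neq (G : sgraph) (u v : G) : adj u v -> u != v.
Proof. by move=> uv; apply: contraTneq uv => ->; rewrite adj_irr. Qed.

Lemma P2_free_bound k (G : sgraph) (I : {set G}) x y :
  induced_free (disjoint_union (path_graph 2) (copies k (path_graph 1))) G ->
  adj x y -> {in I &, forall u v, ~~ adj u v} ->
  {in I, forall u, [&& u \notin [:: x; y], ~~ adj x u & ~~ adj y u]} -> #|I| < k.
Proof.
move=> freeG xy I_indep HI; rewrite ltnNge; apply/negP => kI.
have neq := adj_neq xy.
have yx : adj y x by rewrite adj_sym.
pose p (i : 'I_2) := nth x [:: x; y] i.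
apply: (@path_and_independent_not_free 2 k G p I) freeG => //.
- move=> i j /eqP; rewrite nth_uniq //= ?inE ?neq //.
  by move=> /eqP/val_inj.
- by move=> [[|[|i]] Hi] [[|[|j]] Hj]; rewrite /p //= ?adj_irr ?xy ?yx.
move=> i u /HI; rewrite !inE !negb_or => /and3P[/andP[ux uy] xu yu].
by case: i => [[|[|i]] Hi]; rewrite /p //= eq_sym ?ux ?uy.
Qed.

Lemma P4_free_bound k (G : sgraph) (I : {set G}) t x y z :
  induced_free (disjoint_union (path_graph 4) (copies k (path_graph 1))) G ->
  [&& adj t x, adj x y & adj y z] -> [&& ~~ adj t y, ~~ adj t z & ~~ adj x z] ->
  t != z -> {in I &, forall u v, ~~ adj u v} ->
  {in I, forall u, [&& u \notin [:: t; x; y; z],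
     ~~ adj t u, ~~ adj x u, ~~ adj y u & ~~ adj z u]} -> #|I| < k.
Proof.
move=> freeG /and3P[tx xy yz] /and3P[nty ntz nxz] tz I_indep HI.
rewrite ltnNge; apply/negP => kI.
have [tx' xy' yz'] := And3 (adj_neq tx) (adj_neq xy) (adj_neq yz).
have ty : t != y by apply: contraTneq yz => <-.
have xz : x != z by apply: contraTneq tx => ->.
pose p (i : 'I_4) := nth x [:: t; x; y; z] i.
apply: (@path_and_independent_not_free 4 k G p I) freeG => //.
- move=> i j /eqP; rewrite nth_uniq //= ?inE ?negb_or ?ty ?tz ?xz ?tx' ?xy' ?yz' //.
  by move=> /eqP/val_inj.
- have sym u v := @adj_sym G u v.
  by move=> [[|[|[|[|i]]]] Hi] [[|[|[|[|j]]]] Hj]; rewrite /p //= ?adj_irr //;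
    rewrite ?tx ?xy ?yz ?(negPf nty) ?(negPf ntz) ?(negPf nxz) //;
    rewrite sym ?tx ?xy ?yz ?(negPf nty) ?(negPf ntz) ?(negPf nxz).
move=> i u /HI; rewrite !inE !negb_or => /and5P[/and4P[ut ux uy uz] tu xu yu zu].
by case: i => [[|[|[|[|i]]]] Hi]; rewrite /p //= eq_sym ?ut ?ux ?uy ?uz.
Qed.

Lemma P3_free_P4_free k (G : sgraph) :
  induced_free (disjoint_union (path_graph 3) (copies k (path_graph 1))) G ->
  induced_free (disjoint_union (path_graph 4) (copies k (path_graph 1))) G.
Proof.
pose j (v : disjoint_union (path_graph 3) (copies k (path_graph 1))) :
    disjoint_union (path_graph 4) (copies k (path_graph 1)) :=
  match v with inl i => inl (widen_ord (leqnSn 3) i) | inr c => inr c end.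
apply: (@induced_free_embedding _ _ G j).
  by move=> [a|a] [b|b] //= [] E; [congr inl; apply: val_inj | rewrite E].
by move=> [a|a] [b|b].
Qed.

(** * Biased barriers against toughness and connectivity *)

Section Barriers.

Variables (G : sgraph) (S T : {set G}) (P : {set {set G}}).

Hypothesis bST : biased_barrier S T P.

Let TnS t : t \in T -> t \notin S.
Proof. by move=> tT; rewrite (disjointFl (bb_disjoint bST) tT). Qed.

Let blockU C x : C \in P -> x \in C -> (x \notin S) && (x \notin T).
Proof.
by move=> /(bb_sub bST)/subsetP CU /CU; rewrite in_setC in_setU negb_or.
Qed.

Let blockN C x y : C \in P -> x \in C -> y \notin S -> y \notin T -> adj x y -> y \in C.
Proof.
move=> CP xC yS yT xy; have /closed_inP := bb_closed bST CP; apply; eauto.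
by rewrite in_setC in_setU negb_or yS.
Qed.

Let nbr_in_block t x : t \in T -> x \notin S -> adj t x -> exists2 C, C \in P & x \in C.
Proof. by move=> tT xS tx; have /bigcupP[C CP xC] := bb_cover bST tT xS tx; exists C. Qed.

Let edge_mem C x t : C \in P -> x \in C -> t \in T -> adj x t -> (x, t) \in edges C T.
Proof. by move=> CP xC tT xt; rewrite inE xC tT. Qed.

Lemma sum_edges_block : \sum_(C in P) #|edges C T| <= #|edges T (~: S)|.
Proof.
rewrite card_edgesC; pose E := edges (~: S) T.
have cE C : C \in P -> #|edges C T| = \sum_(p in E) (p.1 \in C : nat).
  move=> CP; rewrite -sum1_card big_mkcond [RHS]big_mkcond; apply: eq_bigr => p _.
  rewrite !inE; have [pC|pC] := boolP (p.1 \in C) => /=; last by rewrite if_same.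
  by have /andP[-> _] := blockU CP pC; case: ifP.
rewrite (eq_bigr _ cE) exchange_big -sum1_card; apply: leq_sum => p _.
rewrite -big_mkcondr sum1_card; apply/card_le1_eqP => C D /andP[CP pC] /andP[DP pD].
exact: esym (bb_blocks bST CP DP pC pD).
Qed.

Let oneE C : C \in P -> #|edges C T| <= 1 ->
  {in C & T, forall x t, adj x t -> {in C & T, forall y u, adj y u -> (x, t) = (y, u)}}.
Proof.
move=> CP /card_le1_eqP H x t xC tT xt y u yC uT yu.
by apply: H; apply: edge_mem.
Qed.

Hypothesis tough1 : tough 1 G.

Lemma tough1_no_cut_vertex v (C : {set G}) x y :
  (forall a b, a \in C -> b != v -> adj a b -> b \in C) ->
  x \in C -> x != v -> y \notin C -> y != v -> False.
Proof.
move=> cC xC xv yC yv.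
have sep : separating [set v] (fun a => a \in C).
  move=> a b; rewrite !inE => av bv ab; apply/idP/idP => H; first exact: cC ab.
  by apply: cC H av _; rewrite adj_sym.
have xy : x != y by apply: contraNneq yC => <-.
have := @tough1_label G _ [set v] [set x; y] _ tough1 sep.
rewrite cards2 cards1 xy /= => H; have : 1 < 1; last by [].
apply: H => //.
  by apply/pred0P => z /=; rewrite !inE; apply/negP => /andP[/orP[]/eqP-> ]; apply/negP.
by move=> a b /set2P[]-> /set2P[]-> //; rewrite xC (negPf yC).
Qed.

Variable r : nat.
Hypothesis r_gt0 : 0 < r.
Hypothesis r_conn : m_connected r G.
Hypothesis G3 : 3 <= #|G|.

Let count : 2 * #|S| + \sum_(C in P) #|edges C T| + 2 <= 2 * #|T| + #|P|.
Proof.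
apply: leq_trans (bb_count bST); rewrite leq_add2r leq_add2l; exact: sum_edges_block.
Qed.

Let other (a b : G) : exists y, (y != a) && (y != b).
Proof.
have : 0 < #|~: [set a; b]|.
  by have := cardsC [set a; b]; rewrite cards2; move: G3; case: (a != b); lia.
by move=> /card_gt0P[y]; rewrite !inE negb_or; exists y.
Qed.

(** This is where toughness is used: G - S separates the vertices of T when each block
    is joined to T by a single edge. *)
Let all_pendant : (forall C, C \in P -> #|edges C T| <= 1) -> False.
Proof.
move=> pend.
have ST : #|S| < #|T|.
  have : \sum_(C in P) #|edges C T| = #|P|.
    rewrite -sum1_card; apply: eq_bigr => C CP; apply/eqP.
    by rewrite eqn_leq pend //= lt0n; apply: contraTneq (bb_odd bST CP) => ->.
  move: count => + E; rewrite E; clear; lia.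
(* The label of a vertex is the vertex of T to which it stays attached in G - S. *)
pose hook v t := [exists C in P, (v \in C) && [exists x in C, adj x t]].
pose g v := if v \in T then Some v else [pick t in T | hook v t].
have g_hook u w : u \in T -> w \notin T -> w \notin S -> adj u w -> g u = g w.
  move=> uT wT wS uw; rewrite /g uT (negPf wT).
  have [C CP wC] := nbr_in_block uT wS uw.
  have wu : adj w u by rewrite adj_sym.
  case: pickP => [t /andP[tT]|/(_ u)].
    move=> /exists_inP[D DP /andP[wD /exists_inP[x xD xt]]].
    have CD := bb_blocks bST CP DP wC wD; rewrite -CD in xD.
    by have [_ ->] := oneE CP (pend C CP) wC uT wu xD tT xt.
  rewrite uT /= => /negbT/negP[]; apply/exists_inP; exists C => //; rewrite wC.
  by apply/exists_inP; exists w.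
have hookS u w t : u \notin S -> w \notin S -> u \notin T -> w \notin T ->
    adj u w -> hook u t -> hook w t.
  move=> uS wS uT wT uw /exists_inP[C CP /andP[uC xC]].
  by apply/exists_inP; exists C; rewrite // xC andbT; apply: blockN CP uC wS wT uw.
have sep : separating S g.
  move=> u w uS wS uw; have wu : adj w u by rewrite adj_sym.
  have [uT|uT] := boolP (u \in T); have [wT|wT] := boolP (w \in T).
  - by have := bb_indep bST uT wT; rewrite uw.
  - exact: g_hook.
  - by apply/esym/g_hook.
  rewrite /g (negPf uT) (negPf wT); apply: eq_pick => t.
  by congr (_ && _); apply/idP/idP; apply: hookS.
have [T2|T1] := ltnP 1 #|T|.
  have dTS : [disjoint T & S] by rewrite disjoint_sym (bb_disjoint bST).
  have gI : {in T &, injective g} by move=> t u tT uT; rewrite /g tT uT => -[].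
  by have := tough1_label tough1 sep dTS gI T2; rewrite leqNgt ST.
(* Here S is empty and T = {t0}: either t0 is a cut vertex, or t0 has a single
   neighbour x and x is one. *)
have [t0 tE] : exists t, T = [set t].
  by apply/cards1P; rewrite eqn_leq T1; apply: leq_trans ST.
have S0 : S = set0 by apply/eqP; rewrite -cards_eq0; move: ST T1; clear; lia.
have notS v : v \notin S by rewrite S0 inE.
have tT : t0 \in T by rewrite tE inE.
have [x tx] : exists x, adj t0 x.
  have [/existsP //|/existsPn no] := boolP [exists x, adj t0 x].
  have [_ _ H] := r_conn.
  have con : connected (delete (set0 : {set G})) by apply: H; rewrite cards0.
  have sep0 : separating set0 (fun v => v == t0).
    move=> a b _ _ ab; apply/eqP/eqP => E.
      by have := no b; rewrite -E ab.
    by have := no a; rewrite -E adj_sym ab.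
  have [y /andP[yt _]] := other t0 t0.
  have := @connected_delete_label G _ _ _ t0 y con sep0; rewrite !inE eqxx => /(_ isT isT).
  by rewrite (negPf yt).
have [C CP xC] := nbr_in_block tT (notS x) tx.
have xt0 : adj x t0 by rewrite adj_sym.
have xt := adj_neq xt0.
have inT b : (b \in T) = (b == t0) by rewrite tE inE.
have [/existsP[y /andP[yC yt]]|/existsPn allC] := boolP [exists y, (y \notin C) && (y != t0)].
  apply: (@tough1_no_cut_vertex t0 C x y) => // a b aC bt ab.
  by apply: blockN CP aC (notS b) _ ab; rewrite inT.
have memC y : y != t0 -> y \in C by move=> yt; have := allC y; rewrite yt andbT negbK.
have [y /andP[yt yx]] := other t0 x.
apply: (@tough1_no_cut_vertex x [set t0] t0 y); rewrite ?inE // 1?eq_sym //.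
move=> a b /set1P-> bx t0b; rewrite inE; apply/negPn/negP => bt.
have bt0 : adj b t0 by rewrite adj_sym.
have [E] := oneE CP (pend C CP) xC tT xt0 (memC b bt) tT bt0.
by rewrite E eqxx in bx.
Qed.

Let cut (X : {set G}) (A : {set G}) x y : #|X| < r ->
  (forall a b, a \in A -> b \notin X -> adj a b -> b \in A) ->
  x \in A -> x \notin X -> y \notin A -> y \notin X -> False.
Proof.
move=> Xr cA xA xX yA yX; have [_ _ H] := r_conn.
have sep : separating X (fun a => a \in A).
  move=> a b aX bX ab; apply/idP/idP => H'; first exact: cA ab.
  by apply: cA H' aX _; rewrite adj_sym.
have := connected_delete_label (H X Xr) sep xX yX.
by rewrite xA (negPf yA).
Qed.

(** Once |T| <= r, Tutte's inequality makes S so small that S and either one vertex of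
    T or the neighbours of one vertex of T form a cut with fewer than r vertices. *)
Lemma biased_barrier_contradiction :
  (forall C, C \in P -> 1 < #|edges C T| -> #|T| <= r) -> False.
Proof.
move=> Tr; have [/existsP[C1 /andP[C1P e1]]|/existsPn no] :=
  boolP [exists C, (C \in P) && (1 < #|edges C T|)]; last first.
  by apply: all_pendant => C CP; have := no C; rewrite CP /= -leqNgt.
have {Tr} Tr := Tr C1 C1P e1.
have other_t t : 1 < #|T| -> exists2 u, u \in T & u != t.
  move=> T2; have : 0 < #|T :\ t| by have := cardsD1 t T; case: (t \in T); move: T2; clear; lia.
  by move=> /card_gt0P[u /setD1P[? ?]]; exists u.
have e3 C : C \in P -> 1 < #|edges C T| -> 3 <= #|edges C T|.
  move=> CP; rewrite leq_eqVlt => /orP[/eqP E|//].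
  by have := bb_odd bST CP; rewrite -E.
have e_gt0 C : C \in P -> 0 < #|edges C T|.
  by move=> CP; rewrite lt0n; apply: contraTneq (bb_odd bST CP) => ->.
have [/existsP[C0 /andP[C0P e0]]|/existsPn no] :=
    boolP [exists C, (C \in P) && (#|edges C T| <= 1)].
  have sP : #|P| + 2 <= \sum_(C in P) #|edges C T|.
    rewrite -sum1_card (big_setD1 C1 C1P) [X in _ <= X](big_setD1 C1 C1P) /=.
    have : \sum_(C in P :\ C1) 1 <= \sum_(C in P :\ C1) #|edges C T|.
      by apply: leq_sum => C /setD1P[_ /e_gt0].
    have arith a b e : 3 <= e -> a <= b -> 1 + a + 2 <= e + b by clear; lia.
    exact: arith (e3 C1 C1P e1).
  have ST : #|S| + 2 <= #|T| by move: sP count; clear; lia.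
  have /card_gt0P[[x t]] := e_gt0 C0 C0P.
  rewrite inE => /and3P[/= xC tT xt].
  have /andP[xS xT] := blockU C0P xC.
  have [u uT ut] : exists2 u, u \in T & u != t by apply: other_t; move: ST; clear; lia.
  apply: (@cut (t |: S) C0 x u) => //.
  - rewrite cardsU1 (TnS tT); move: ST Tr; clear; lia.
  - move=> a b aC; rewrite in_setU1 negb_or => /andP[bt bS] ab.
    have [bT|bT] := boolP (b \in T); last exact: blockN C0P aC bS bT ab.
    by have [_ E] := oneE C0P e0 xC tT xt aC bT ab; rewrite E eqxx in bt.
  - by rewrite in_setU1 negb_or xS andbT; apply: contraNneq xT => ->.
  - by apply/negP => /(blockU C0P); rewrite uT andbF.
  - by rewrite in_setU1 negb_or ut TnS.
have sP : 3 * #|P| <= \sum_(C in P) #|edges C T|.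
  rewrite mulnC -sum_nat_const; apply: leq_sum => C CP; apply: e3 => //.
  by have := no C; rewrite CP /= -ltnNge.
have P1 : 0 < #|P| by apply/card_gt0P; exists C1.
have STP : #|S| + #|P| + 1 <= #|T| by move: sP count; clear; lia.
have [t tT] : exists t, t \in T by apply/card_gt0P; move: STP; clear; lia.
have [u uT ut] : exists2 u, u \in T & u != t by apply: other_t; move: STP P1; clear; lia.
pose N := [set x | adj t x] :\: S.
have NP : #|N| <= #|P|.
  have NcP x : x \in N -> x \in cover P.
    by rewrite !inE => /andP[xS tx]; apply: (bb_cover bST) tx.
  rewrite -(card_in_imset (_ : {in N &, injective (pblock P)})).
    by apply: subset_leq_card; apply/subsetP => _ /imsetP[x /NcP xP ->]; apply: pblock_mem.
  move=> x y xN yN E; have xP := NcP x xN; have yP := NcP y yN.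
  apply: (bb_uniqC bST (pblock_mem xP) _ _ tT).
  - by rewrite mem_pblock.
  - by rewrite E mem_pblock.
  - by move: xN; rewrite !inE adj_sym => /andP[].
  - by move: yN; rewrite !inE adj_sym => /andP[].
apply: (@cut (S :|: N) [set t] t u) => //.
- have [+ _] := leq_card_setU S N; move: NP STP Tr; clear; lia.
- move=> a b /set1P-> + tb; rewrite !inE tb andbT negb_or negbK.
  by case: (b \in S).
- by rewrite inE.
- by rewrite !inE negb_or TnS //= adj_irr.
- by rewrite inE.
- by rewrite !inE negb_or TnS //= (bb_indep bST tT uT).
Qed.

End Barriers.

(** * Bounding T by forbidden linear forests *)

Section Bounds.

Variables (G : sgraph) (S T : {set G}) (P : {set {set G}}) (k : nat).

Hypothesis bST : biased_barrier S T P.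

Let blockU C x : C \in P -> x \in C -> x \notin S :|: T.
Proof. by move=> /(bb_sub bST)/subsetP CU /CU; rewrite in_setC. Qed.

Let block_neq C x t : C \in P -> x \in C -> t \in T -> x != t.
Proof.
move=> CP xC tT; apply: contraNneq (blockU CP xC) => ->.
by rewrite in_setU tT orbT.
Qed.

Let only_neighbour C x t u : C \in P -> x \in C -> t \in T -> u \in T ->
  adj x t -> u != t -> ~~ adj x u.
Proof.
move=> CP xC tT uT xt; apply: contraNN => xu.
by apply/eqP; apply: (bb_uniqT bST (blockU CP xC)) xu xt.
Qed.

(** An edge xt between a block and T is adjacent to no vertex of T but t. *)
Lemma P2_free_barrier C :
  induced_free (disjoint_union (path_graph 2) (copies k (path_graph 1))) G ->
  C \in P -> 1 < #|edges C T| -> #|T| <= k.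
Proof.
move=> freeG CP /ltnW/card_gt0P[[x t]]; rewrite inE => /and3P[/= xC tT xt].
suff: #|T :\ t| < k by rewrite (cardsD1 t T) tT.
apply: (P2_free_bound freeG xt).
  by move=> u v /setD1P[_ uT] /setD1P[_ vT]; apply: (bb_indep bST uT vT).
move=> u /setD1P[ut uT]; rewrite !inE negb_or ut andbT.
rewrite eq_sym (block_neq CP xC uT) (only_neighbour CP xC tT uT xt ut).
exact: (bb_indep bST tT uT).
Qed.

(** Let x1 and x2 be two vertices of C with neighbours t1 and t2 in T; t1 and t2 are
    distinct. If two adjacent vertices x, y of C have neighbours t, u in T, then
    t x y u is an induced P_4 meeting T in t and u. Otherwise x1 and its
    neighbours in C do not fill the connected set C, so there is a path x1 y z
    in C with z not adjacent to x1; y has no neighbour in T, and t1 x1 y z is an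
    induced P_4 that is adjacent to at most one vertex of T besides t1. *)
Lemma P4_free_barrier C :
  induced_free (disjoint_union (path_graph 4) (copies k (path_graph 1))) G ->
  C \in P -> 1 < #|edges C T| -> #|T| <= k + 1.
Proof.
move=> freeG CP /card_gt1P[[x1 t1] [[x2 t2] []]].
rewrite !inE => /and3P[/= x1C t1T x1t1] /and3P[/= x2C t2T x2t2] neq.
have indep (I : {set G}) : I \subset T -> {in I &, forall u v, ~~ adj u v}.
  move=> IT u v uI vI.
  exact: (bb_indep bST (subsetP IT _ uI) (subsetP IT _ vI)).
have x12 : x1 != x2.
  apply: contraNneq neq => E; rewrite -E in x2t2 *.
  by rewrite (bb_uniqT bST (blockU CP x1C) t1T t2T x1t1 x2t2).
have [/existsP[x /existsP[y /and5P[xC yC xy]]]|noedge] := boolP [exists x, exists y,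
    [&& x \in C, y \in C, adj x y, [exists t in T, adj x t] & [exists u in T, adj y u]]].
  move=> /exists_inP[t tT xt] /exists_inP[u uT yu].
  have ut : u != t.
    apply: contraTneq xy => E; rewrite E in yu.
    by rewrite (bb_uniqC bST CP xC yC tT xt yu) adj_irr.
  have tu : t != u by rewrite eq_sym.
  have IT : T :\ t :\ u \subset T by rewrite (subset_trans (subD1set _ _)) ?subD1set.
  suff: #|T :\ t :\ u| < k.
    by rewrite (cardsD1 t T) tT (cardsD1 u (T :\ t)) !inE ut uT; clear; lia.
  apply: (P4_free_bound (t := t) (x := x) (y := y) (z := u) freeG) => //.
  - by rewrite adj_sym xt xy yu.
  - rewrite (bb_indep bST tT uT) (only_neighbour CP xC tT uT xt ut) andbT /=.
    by rewrite adj_sym (only_neighbour CP yC uT tT yu tu).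
  - exact: indep.
  move=> v /setD1P[vu /setD1P[vt vT]].
  rewrite !inE !negb_or vt vu (eq_sym v x) (eq_sym v y).
  rewrite (block_neq CP xC vT) (block_neq CP yC vT) (bb_indep bST tT vT) (bb_indep bST uT vT).
  by rewrite (only_neighbour CP xC tT vT xt vt) (only_neighbour CP yC uT vT yu vu).
have no_edge x y t u : x \in C -> y \in C -> t \in T -> u \in T ->
    adj x t -> adj y u -> ~~ adj x y.
  move=> xC yC tT uT xt yu; apply: contraNN noedge => xy.
  apply/existsP; exists x; apply/existsP; exists y; rewrite xC yC xy /=.
  by apply/andP; split; apply/exists_inP; [exists t | exists u].
pose D := x1 |: [set y in C | adj x1 y].
have DC : D \subset C.
  by rewrite subUset sub1set x1C; apply/subsetP => y; rewrite inE => /andP[].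
have D0 : D != set0 by apply/set0Pn; exists x1; rewrite !inE eqxx.
have : ~~ closed_in (@adj G) (~: (S :|: T)) D.
  apply/negP => /(bb_connected bST CP DC D0) E.
  have : x2 \in D by rewrite E.
  rewrite !inE eq_sym (negPf x12) x2C /=; apply/negP.
  exact: no_edge x1C x2C t1T t2T x1t1 x2t2.
rewrite negb_forall_in => /exists_inP[y yD]; rewrite negb_forall_in => /exists_inP[z zU].
rewrite negb_imply => /andP[yz zD].
have yC := subsetP DC _ yD.
have zC : z \in C by have /closed_inP H := bb_closed bST CP; apply: H yz.
have [zx1 x1z] : z != x1 /\ ~~ adj x1 z.
  by move: zD; rewrite !inE negb_or zC => /andP[].
have x1y : adj x1 y.
  move: yD; rewrite !inE => /orP[/eqP yx|/andP[]//].
  by rewrite -yx yz in x1z.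
have yT u : u \in T -> ~~ adj y u.
  move=> uT; apply: contraTN x1y => yu.
  exact: no_edge x1C yC t1T uT x1t1 yu.
have t1z : ~~ adj t1 z.
  apply: contraNN zx1; rewrite adj_sym => zt1.
  by apply/eqP; apply: (bb_uniqC bST CP zC x1C t1T zt1 x1t1).
pose I := [set u in T | (u != t1) && ~~ adj z u].
have IT : I \subset T by apply/subsetP => u; rewrite inE => /andP[].
suff Ik : #|I| < k.
  have le1 : #|[set u in T | adj z u]| <= 1.
    apply/card_le1_eqP => u v; rewrite !inE => /andP[uT zu] /andP[vT zv].
    exact: (bb_uniqT bST (blockU CP zC) vT uT zv zu).
  have : T \subset I :|: (t1 |: [set u in T | adj z u]).
    by apply/subsetP => u uT; rewrite !inE uT /=; case: (u == t1); case: (adj z u).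
  move=> /subset_leq_card; have [+ _] := leq_card_setU I (t1 |: [set u in T | adj z u]).
  rewrite cardsU1; have := leq_b1 (t1 \notin [set u in T | adj z u]).
  have arith a b c i tt u : a <= 1 -> u <= i + (a + b) -> tt <= u -> b <= 1 -> i < c -> tt <= c + 1.
    by clear; lia.
  move=> h1 h2 h3; exact: arith h1 h2 h3 le1 Ik.
apply: (P4_free_bound (t := t1) (x := x1) (y := y) (z := z) freeG) => //.
- by rewrite adj_sym x1t1 x1y yz.
- by rewrite adj_sym yT // t1z x1z.
- by rewrite eq_sym (block_neq CP zC).
- exact: indep.
move=> u; rewrite inE => /and3P[uT ut zu].
rewrite !inE !negb_or ut zu (eq_sym u x1) (eq_sym u y) (eq_sym u z) yT //.
rewrite (block_neq CP x1C uT) (block_neq CP yC uT) (block_neq CP zC uT).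
by rewrite (bb_indep bST t1T uT) (only_neighbour CP x1C t1T uT x1t1 ut).
Qed.

End Bounds.

Theorem theorem3 :
  (forall (l k : nat) (G : sgraph),
     l = 1 \/ l = 2 -> 0 < k -> 3 <= #|G| ->
     tough 1 G -> m_connected (k + l - 1) G ->
     induced_free (disjoint_union (path_graph (2 * l)) (copies k (path_graph 1))) G ->
     has_2factor G)
  /\
  (forall (k : nat) (G : sgraph),
     0 < k -> 3 <= #|G| ->
     tough 1 G -> m_connected (k + 1) G ->
     induced_free (disjoint_union (path_graph 3) (copies k (path_graph 1))) G ->
     has_2factor G).
Proof.
have P4case k (G : sgraph) : 3 <= #|G| -> tough 1 G -> m_connected (k + 1) G ->
    induced_free (disjoint_union (path_graph 4) (copies k (path_graph 1))) G ->
    has_2factor G.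
  move=> G3 tG cG freeG; have [//|[S [T [P bST]]]] := has_2factor_or_biased_barrier G.
  have r0 : 0 < k + 1 by rewrite addn1.
  case: (biased_barrier_contradiction bST tG r0 cG G3) => C CP eC.
  exact: (P4_free_barrier bST freeG CP eC).
split=> [l k G|k G k0 G3 tG cG freeG]; last exact: P4case (P3_free_P4_free freeG).
case=> -> k0 G3 tG; last by rewrite -addnBA //; apply: P4case.
rewrite addnK => cG freeG; have [//|[S [T [P bST]]]] := has_2factor_or_biased_barrier G.
case: (biased_barrier_contradiction bST tG k0 cG G3) => C CP eC.
exact: (P2_free_barrier bST freeG CP eC).
Qed.
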